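(* Let $\mathfrak{C}$ be an abelian category (not necessarily with enough projective objects), and let $(\mathcal{X},\mathcal{X}^\perp)$ be a hereditary cotorsion pair in $\mathfrak{C}$ such that every object in $\mathcal{X}^\wedge$ has a special $\mathcal{X}$-precover and a special $\mathcal{X}^\perp$-preenvelope. Let $\omega=\mathcal{X}\cap\mathcal{X}^\perp$, and suppose that $(\omega^\wedge_m,[\omega^\wedge_m]^{\perp_1})$ is a complete cotorsion pair in $\mathfrak{C}$ for some $m\in\mathbb{Z}_{\geq 0}$. Then for every $n\geq m$ such that $\omega^\wedge_n$ is closed under epikernels, there is a hereditary Hovey triple in the weakly idempotent complete exact subcategory $\mathcal{X}^\wedge_n$ given by $$(\mathcal{X}^\wedge_m,\ \omega^\wedge_n,\ [\omega^\wedge_m]^{\perp_1}\cap\mathcal{X}^\wedge_n).$$ The homotopy category of its associated hereditary model structure is equivalent to the quotient category $(\mathcal{X}^\wedge_m\cap[\omega^\wedge_m]^{\perp_1})/\sim$, where for two morphisms $f,g\colon X\to Y$ with $X,Y\in\mathcal{X}^\wedge_m\cap[\omega^\wedge_m]^{\perp_1}$ one has $f\sim g$ if, and only if, $f-g$ factors through a trivially bifibrant object (that is, an object in $\omega^\wedge_m\cap[\omega^\wedge_m]^{\perp_1}$).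
   Context: $A\rightarrowtail B\twoheadrightarrow C$ denotes a short exact sequence. $\mathrm{Ext}^i_{\mathfrak C}$ is Yoneda Ext. For a class $\mathcal{X}$: $\mathcal{X}^{\perp_i}=\{N: \mathrm{Ext}^i_{\mathfrak C}(X,N)=0\ \forall X\in\mathcal X\}$ for $i>0$, $\mathcal{X}^\perp=\bigcap_{i>0}\mathcal{X}^{\perp_i}$; ${}^{\perp_1}\mathcal X$ is dual. $\mathcal{X}^\wedge_m$ is the class of objects $M$ having an exact sequence $0\to X_m\to\cdots\to X_0\to M\to 0$ with all $X_i\in\mathcal{X}$; $\mathcal{X}^\wedge=\bigcup_{m\ge 0}\mathcal{X}^\wedge_m$. Closed under epikernels means closed under kernels of epimorphisms between objects of the class. A special $\mathcal A$-precover of $M$ is a short exact sequence $D\rightarrowtail A\twoheadrightarrow M$ with $A\in\mathcal A$, $D\in\mathcal A^{\perp_1}$; a special $\mathcal D$-preenvelope of $M$ is a short exact sequence $M\rightarrowtail D\twoheadrightarrow A$ with $D\in\mathcal D$, $A\in{}^{\perp_1}\mathcal D$. A cotorsion pair $(\mathcal A,\mathcal D)$ in $\mathfrak C$: $\mathcal A^{\perp_1}=\mathcal D$ and $\mathcal A={}^{\perp_1}\mathcal D$. It is complete if every object has a special $\mathcal A$-precover and a special $\mathcal D$-preenvelope; hereditary if $\mathrm{Ext}^i_{\mathfrak C}(A,D)=0$ for all $A\in\mathcal A$, $D\in\mathcal D$, $i>0$. In this setting $\mathcal X^\wedge_n$ is closed under extensions, epikernels and direct summands in $\mathfrak C$;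 it is regarded as a weakly idempotent complete exact category with conflations the short exact sequences of $\mathfrak C$ with all terms in $\mathcal X^\wedge_n$. Cotorsion pairs, completeness and hereditariness in an exact category are defined in the same way, using conflations and the Ext groups of the exact category. A Hovey triple $(\mathcal Q,\mathcal W,\mathcal R)$ in an exact category $\mathcal E$: $\mathcal W$ is thick in $\mathcal E$ (closed under direct summands, and if two terms of a conflation lie in $\mathcal W$ so does the third), and $(\mathcal Q\cap\mathcal W,\mathcal R)$, $(\mathcal Q,\mathcal W\cap\mathcal R)$ are complete cotorsion pairs in $\mathcal E$; it is hereditary if both pairs are hereditary. Its associated (exact) model structure has as (trivial) cofibrations the admissible monomorphisms with cokernel in $\mathcal Q$ (resp. $\mathcal Q\cap\mathcal W$), as (trivial) fibrations the admissible epimorphisms with kernel in $\mathcal R$ (resp. $\mathcal W\cap\mathcal R$), and as weak equivalences the composites of a trivial cofibration followed by a trivial fibration. Bifibrant means in $\mathcal Q\cap\mathcal R$, trivially bifibrant means in $\mathcal Q\cap\mathcal W\cap\mathcal R$. The homotopy category is the localization at the weak equivalences. *)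

(* Defs.v *)
From mathcomp Require Import all_boot ssralg.
From mathcomp Require Import boolp classical_sets.
From Stdlib Require Import Relation_Operators.

Set Implicit Arguments.
Unset Strict Implicit.
Unset Printing Implicit Defensive.

Import GRing.Theory.

Local Open Scope classical_set_scope.
Local Open Scope ring_scope.

Declare Scope cat_scope.
Delimit Scope cat_scope with cat.
Local Open Scope cat_scope.

(* The choice structure packed in [zmodType] is no restriction: classically
   every type carries one. *)
Record preadditive_category := PreadditiveCategory {
  obj :> Type;
  hom : obj -> obj -> zmodType;
  idm : forall A, hom A A;
  comp : forall A B D, hom B D -> hom A B -> hom A D;
  comp1m : forall A B (f : hom A B), comp (idm B) f = f;
  compm1 : forall A B (f : hom A B), comp f (idm A) = f;
  compA : forall A B D G (h : hom D G) (g : hom B D) (f : hom A B),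
    comp h (comp g f) = comp (comp h g) f;
  compDl : forall A B D (g g' : hom B D) (f : hom A B),
    comp (g + g') f = comp g f + comp g' f;
  compDr : forall A B D (g : hom B D) (f f' : hom A B),
    comp g (f + f') = comp g f + comp g f'
}.

Arguments hom {p} A B.
Arguments idm {p} A.
Arguments comp {p A B D} g f.

(* Composition in the usual order: [g \o f] is f followed by g. *)
Notation "g \o f" := (comp g f) : cat_scope.

Section Preadditive.
Context {C : preadditive_category}.

Definition mono (A B : C) (f : hom A B) : Prop :=
  forall T (u v : hom T A), f \o u = f \o v -> u = v.

Definition epi (A B : C) (f : hom A B) : Prop :=
  forall T (u v : hom B T), u \o f = v \o f -> u = v.

Definition is_zero (Z : C) : Prop := idm Z = 0.

Definition is_kernel (K A B : C) (f : hom A B) (k : hom K A) : Prop :=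
  f \o k = 0 /\
  forall T (t : hom T A), f \o t = 0 -> exists! u : hom T K, k \o u = t.

Definition is_cokernel (A B Q : C) (f : hom A B) (q : hom B Q) : Prop :=
  q \o f = 0 /\
  forall T (t : hom B T), t \o f = 0 -> exists! u : hom Q T, u \o q = t.

Definition is_biproduct (A B S : C) (i1 : hom A S) (i2 : hom B S)
    (p1 : hom S A) (p2 : hom S B) : Prop :=
  [/\ p1 \o i1 = idm A, p2 \o i2 = idm B, p1 \o i2 = 0, p2 \o i1 = 0
    & (i1 \o p1) + (i2 \o p2) = idm S].

(* The image of f (the kernel of its cokernel) is the kernel of g. *)
Definition exact (A B D : C) (f : hom A B) (g : hom B D) : Prop :=
  exists (I Q : C) (k : hom I B) (q : hom B Q),
    [/\ is_cokernel f q, is_kernel q k & is_kernel g k].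

Definition short_exact (A B D : C) (i : hom A B) (p : hom B D) : Prop :=
  is_kernel p i /\ is_cokernel i p.

End Preadditive.

Record abelian_category := AbelianCategory {
  abcat :> preadditive_category;
  ab_zero : exists Z : abcat, is_zero Z;
  ab_biproduct : forall A B : abcat,
    exists S (i1 : hom A S) (i2 : hom B S) (p1 : hom S A) (p2 : hom S B),
      is_biproduct i1 i2 p1 p2;
  ab_kernel : forall (A B : abcat) (f : hom A B),
    exists K (k : hom K A), is_kernel f k;
  ab_cokernel : forall (A B : abcat) (f : hom A B),
    exists Q (q : hom B Q), is_cokernel f q;
  ab_mono : forall (A B : abcat) (f : hom A B),
    mono f -> exists D (g : hom B D), is_kernel g f;
  ab_epi : forall (A B : abcat) (f : hom A B),
    epi f -> exists D (g : hom D A), is_cokernel g f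
}.

Section Classes.
Context {C : abelian_category}.
Implicit Types (E X Y Q W R : set C) (A B D K M N : C).

Definition closed_extensions X : Prop :=
  forall A B D (i : hom A B) (p : hom B D),
    short_exact i p -> X A -> X D -> X B.

Definition closed_epikernels X : Prop :=
  forall K B D (k : hom K B) (p : hom B D),
    epi p -> is_kernel p k -> X B -> X D -> X K.

(* The resolution 0 -> F m -> ... -> F 0 -> M -> 0 is stored as an infinite
   complex which vanishes in degrees > m; exactness at F m is injectivity of
   F m -> F m.-1 (of F 0 -> M when m = 0). *)
Definition hat X (m : nat) : set C := [set M |
  exists (F : nat -> C) (d : forall i, hom (F i.+1) (F i)) (e : hom (F 0%N) M),
    [/\ (forall i, (i <= m)%N -> X (F i)),
        (forall i, (m < i)%N -> is_zero (F i)),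
        epi e, exact (d 0%N) e
      & forall i, exact (d i.+1) (d i)]].

Definition hat_fin X : set C := [set M | exists m, hat X m M].

(* A class E that contains 0 and is closed under extensions is an exact
   category whose conflations are the short exact sequences with terms in E.
   All notions below are relative to such an E; the case E = setT is the
   abelian category itself. *)

Definition conflation E A B D (i : hom A B) (p : hom B D) : Prop :=
  [/\ E A, E B, E D & short_exact i p].

(* Weakly idempotent complete: every retraction of the subcategory has a
   kernel in it. *)
Definition wic_exact_subcategory E : Prop :=
  [/\ (forall Z : C, is_zero Z -> E Z), closed_extensions E
    & forall K B D (k : hom K B) (r : hom B D) (s : hom D B),
        E B -> E D -> r \o s = idm D -> is_kernel r k -> E K].

Record extension1 E A D := Extension1 {
  ext_mid : C;
  ext_inj : hom D ext_mid;
  ext_prj : hom ext_mid A;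
  ext_confl : conflation E ext_inj ext_prj
}.

(* [yext E j A D] is the type of exact sequences of E
   0 -> D -> B_(j+1) -> ... -> B_1 -> A -> 0 (the representatives of
   Ext^(j+1)(A, D)), given as splices of conflations. *)
Fixpoint yext E (j : nat) A D : Type :=
  if j is j'.+1 then {K : C & (extension1 E A K * yext E j' K D)%type}
  else extension1 E A D.

Definition extension1_mor E A D A' D' (a : hom A A') (d : hom D D')
    (e : extension1 E A D) (e' : extension1 E A' D') : Prop :=
  exists b : hom (ext_mid e) (ext_mid e'),
    b \o ext_inj e = ext_inj e' \o d /\ ext_prj e' \o b = a \o ext_prj e.

Fixpoint yext_mor E (j : nat) A D A' D' (a : hom A A') (d : hom D D') :
    yext E j A D -> yext E j A' D' -> Prop :=
  match j return yext E j A D -> yext E j A' D' -> Prop with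
  | 0%N => fun e e' => extension1_mor a d e e'
  | j'.+1 => fun e e' => exists k : hom (projT1 e) (projT1 e'),
      extension1_mor a k (projT2 e).1 (projT2 e').1 /\
      yext_mor k d (projT2 e).2 (projT2 e').2
  end.

(* Yoneda equivalence is generated by the morphisms of exact sequences that
   are the identity at both ends. *)
Definition yext_equiv E j A D : yext E j A D -> yext E j A D -> Prop :=
  clos_refl_sym_trans _ (fun e e' => yext_mor (idm A) (idm D) e e').

(* Ext^i_E(A, D) = 0: the group of Yoneda classes has a single element.
   Only i > 0 is used; Ext^0 is Hom. *)
Definition Ext_eq0 E (i : nat) A D : Prop :=
  if i is j.+1 then forall e e' : yext E j A D, yext_equiv e e'
  else forall f : hom A D, f = 0.

Definition rperpi E (i : nat) X : set C :=
  [set N | E N /\ forall A, X A -> Ext_eq0 E i A N].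

Definition lperpi E (i : nat) X : set C :=
  [set M | E M /\ forall D, X D -> Ext_eq0 E i M D].

Definition rperp E X : set C :=
  [set N | forall i, (0 < i)%N -> rperpi E i X N].

Definition special_precover E X M : Prop :=
  exists D A (i : hom D A) (p : hom A M),
    [/\ conflation E i p, X A & rperpi E 1 X D].

Definition special_preenvelope E X M : Prop :=
  exists D A (i : hom M D) (p : hom D A),
    [/\ conflation E i p, X D & lperpi E 1 X A].

Definition cotorsion_pair E X Y : Prop :=
  rperpi E 1 X = Y /\ X = lperpi E 1 Y.

Definition complete_cotorsion_pair E X Y : Prop :=
  cotorsion_pair E X Y /\
  forall M, E M -> special_precover E X M /\ special_preenvelope E Y M.

Definition hereditary E X Y : Prop :=
  forall A D i, X A -> Y D -> (0 < i)%N -> Ext_eq0 E i A D.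

Definition thick E W : Prop :=
  [/\ W `<=` E,
      (forall A B S (i1 : hom A S) (i2 : hom B S) (p1 : hom S A) (p2 : hom S B),
         is_biproduct i1 i2 p1 p2 -> E A -> E B -> W S -> W A)
    & forall A B D (i : hom A B) (p : hom B D), conflation E i p ->
        [/\ (W A -> W B -> W D), (W A -> W D -> W B) & (W B -> W D -> W A)]].

Definition hovey_triple E Q W R : Prop :=
  [/\ thick E W, complete_cotorsion_pair E (Q `&` W) R
    & complete_cotorsion_pair E Q (W `&` R)].

Definition hereditary_hovey_triple E Q W R : Prop :=
  [/\ hovey_triple E Q W R, hereditary E (Q `&` W) R
    & hereditary E Q (W `&` R)].

Definition inflation_in E Q A B (f : hom A B) : Prop :=
  exists D (p : hom B D), conflation E f p /\ Q D.

Definition deflation_in E R A B (f : hom A B) : Prop :=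
  exists K (k : hom K A), conflation E k f /\ R K.

Definition cofibration E Q := inflation_in E Q.
Definition trivial_cofibration E Q W := inflation_in E (Q `&` W).
Definition fibration E R := deflation_in E R.
Definition trivial_fibration E W R := deflation_in E (W `&` R).

Definition weak_equivalence E Q W R A B (f : hom A B) : Prop :=
  exists Z (i : hom A Z) (p : hom Z B),
    [/\ trivial_cofibration E Q W i, trivial_fibration E W R p
      & f = p \o i].

Definition trivially_bifibrant Q W R : set C := Q `&` W `&` R.

Definition factors_through (S : set C) A B (f : hom A B) : Prop :=
  exists Z (u : hom A Z) (v : hom Z B), S Z /\ f = v \o u.

End Classes.

(* Hom-sets of localizations and quotients are presented as setoids: the
   morphisms of [category] are the elements of [mor] up to [meq]. *)

Record category := Category {
  ob :> Type;
  mor : ob -> ob -> Type;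
  meq : forall A B, mor A B -> mor A B -> Prop;
  mid : forall A, mor A A;
  mcomp : forall A B D, mor B D -> mor A B -> mor A D;
  meq_refl : forall A B (f : mor A B), meq f f;
  meq_sym : forall A B (f g : mor A B), meq f g -> meq g f;
  meq_trans : forall A B (f g h : mor A B), meq f g -> meq g h -> meq f h;
  mcomp_meq : forall A B D (g g' : mor B D) (f f' : mor A B),
    meq g g' -> meq f f' -> meq (mcomp g f) (mcomp g' f');
  mcomp1m : forall A B (f : mor A B), meq (mcomp (mid B) f) f;
  mcompm1 : forall A B (f : mor A B), meq (mcomp f (mid A)) f;
  mcompA : forall A B D G (h : mor D G) (g : mor B D) (f : mor A B),
    meq (mcomp h (mcomp g f)) (mcomp (mcomp h g) f)
}.

Arguments mor {c} A B.
Arguments meq {c A B} f g.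
Arguments mid {c} A.
Arguments mcomp {c A B D} g f.

Record functor (A B : category) := Functor {
  fob :> A -> B;
  fmor : forall X Y, mor X Y -> mor (fob X) (fob Y);
  fmor_meq : forall X Y (f g : @mor A X Y), meq f g -> meq (fmor f) (fmor g);
  fmor1 : forall X, meq (fmor (mid X)) (mid (fob X));
  fmorM : forall X Y Z (g : @mor A Y Z) (f : mor X Y),
    meq (fmor (mcomp g f)) (mcomp (fmor g) (fmor f))
}.

Definition is_iso (A : category) (X Y : A) (f : mor X Y) : Prop :=
  exists g : mor Y X, meq (mcomp g f) (mid X) /\ meq (mcomp f g) (mid Y).

Definition equivalent_categories (A B : category) : Prop :=
  exists (F : functor A B) (G : functor B A)
    (eta : forall X : A, mor X (G (F X))) (eps : forall Y : B, mor (F (G Y)) Y),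
    [/\ (forall X, is_iso (eta X)), (forall Y, is_iso (eps Y)),
        (forall (X X' : A) (f : mor X X'),
           meq (mcomp (fmor G (fmor F f)) (eta X)) (mcomp (eta X') f))
      & (forall (Y Y' : B) (g : mor Y Y'),
           meq (mcomp (eps Y') (fmor F (fmor G g))) (mcomp g (eps Y)))].

Definition full_subcategory (C : preadditive_category) (P : set C) : category.
Proof.
refine (@Category {A : C | P A} (fun A B => hom (sval A) (sval B))
  (fun _ _ f g => f = g) (fun A => idm (sval A)) (fun _ _ _ g f => g \o f)
  _ _ _ _ _ _ _).
- by [].
- by [].
- by move=> A B f g h -> ->.
- by move=> A B D g g' f f' -> ->.
- by move=> A B f; rewrite comp1m.
- by move=> A B f; rewrite compm1.
- by move=> A B D G h g f; rewrite compA.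
Defined.

Definition congruence (A : category)
    (R : forall X Y : A, mor X Y -> mor X Y -> Prop) : Prop :=
  [/\ (forall X Y (f g : mor X Y), meq f g -> R X Y f g),
      (forall X Y (f g : mor X Y), R X Y f g -> R X Y g f),
      (forall X Y (f g h : mor X Y), R X Y f g -> R X Y g h -> R X Y f h)
    & forall X Y Z (g g' : mor Y Z) (f f' : mor X Y),
        R Y Z g g' -> R X Y f f' -> R X Z (mcomp g f) (mcomp g' f')].

Definition quotient_category (A : category)
    (R : forall X Y : A, mor X Y -> mor X Y -> Prop) (cR : congruence R) :
  category.
Proof.
refine (@Category A (@mor A) R (@mid A) (@mcomp A) _ _ _ _ _ _ _).
- by case: cR => R1 _ _ _ X Y f; apply/R1/meq_refl.
- by case: cR.
- by case: cR.
- by case: cR.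
- by case: cR => R1 _ _ _ X Y f; apply/R1/mcomp1m.
- by case: cR => R1 _ _ _ X Y f; apply/R1/mcompm1.
- by case: cR => R1 _ _ _ X Y Z T h g f; apply/R1/mcompA.
Defined.

(* Localization of A at W, by generators (the morphisms of A and formal
   inverses of those in W) and relations. *)
Section Localization.
Context (A : category) (W : forall X Y : A, mor X Y -> Prop).

Inductive loc_mor : A -> A -> Type :=
| loc_of X Y : mor X Y -> loc_mor X Y
| loc_inv X Y (s : mor X Y) : W s -> loc_mor Y X
| loc_comp X Y Z : loc_mor Y Z -> loc_mor X Y -> loc_mor X Z.

Inductive loc_eq : forall X Y, loc_mor X Y -> loc_mor X Y -> Prop :=
| loc_refl X Y (f : loc_mor X Y) : loc_eq f f
| loc_sym X Y (f g : loc_mor X Y) : loc_eq f g -> loc_eq g f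
| loc_trans X Y (f g h : loc_mor X Y) :
    loc_eq f g -> loc_eq g h -> loc_eq f h
| loc_comp_eq X Y Z (g g' : loc_mor Y Z) (f f' : loc_mor X Y) :
    loc_eq g g' -> loc_eq f f' -> loc_eq (loc_comp g f) (loc_comp g' f')
| loc_comp1m X Y (f : loc_mor X Y) : loc_eq (loc_comp (loc_of (mid Y)) f) f
| loc_compm1 X Y (f : loc_mor X Y) : loc_eq (loc_comp f (loc_of (mid X))) f
| loc_compA X Y Z T (h : loc_mor Z T) (g : loc_mor Y Z) (f : loc_mor X Y) :
    loc_eq (loc_comp h (loc_comp g f)) (loc_comp (loc_comp h g) f)
| loc_of_meq X Y (f g : mor X Y) : meq f g -> loc_eq (loc_of f) (loc_of g)
| loc_of_comp X Y Z (g : mor Y Z) (f : mor X Y) :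
    loc_eq (loc_of (mcomp g f)) (loc_comp (loc_of g) (loc_of f))
| loc_invl X Y (s : mor X Y) (ws : W s) :
    loc_eq (loc_comp (loc_inv ws) (loc_of s)) (loc_of (mid X))
| loc_invr X Y (s : mor X Y) (ws : W s) :
    loc_eq (loc_comp (loc_of s) (loc_inv ws)) (loc_of (mid Y)).

Definition localization : category :=
  @Category A loc_mor loc_eq (fun X => loc_of (mid X)) loc_comp
    loc_refl loc_sym loc_trans loc_comp_eq loc_comp1m loc_compm1 loc_compA.

End Localization.

Definition homotopy_category (C : abelian_category) (E Q W R : set C) :
    category :=
  localization (fun A B : full_subcategory E =>
    @weak_equivalence C E Q W R (sval A) (sval B)).

Definition ideal_rel (C : abelian_category) (P S : set C)
    (A B : full_subcategory P) (f g : hom (sval A) (sval B)) : Prop :=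
  factors_through S (f - g).

(* Main.v *)
(* Let Y be the right orthogonal of X. Vanishing of Ext^2(X, Y) makes X closed
   under epikernels and Y under cokernels of monomorphisms, and lifts
   extensions along special precovers; with the given approximations this
   yields Auslander-Buchweitz theory: the classes X^_k are closed under
   extensions, epikernels and summands, omega^_k is the intersection of X^_k
   with Y, and each M in X^_k embeds in an object of omega^_k with cokernel in
   X. Following such an embedding by a special preenvelope for the given
   cotorsion pair gives special preenvelopes for (X^_m, W /\ R), and Salce's
   pushout gives special precovers.
   For the homotopy category, bifibrant replacements M <- P -> B are
   functorial up to maps through T. A weak equivalence becomes invertible
   because composing with a trivial fibration, or pulling back along a trivial
   cofibration, turns a replacement of one end into a replacement of the other
   with the same B. *)
Require Import Defs.
From mathcomp Require Import all_boot ssralg.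
From mathcomp Require Import boolp classical_sets.
From Stdlib Require Import Relation_Operators Setoid Morphisms.
(* Otherwise [compA] would be that of ssrfun. *)
Import Defs.

Set Implicit Arguments.
Unset Strict Implicit.
Unset Printing Implicit Defensive.

Import GRing.Theory.

Local Open Scope classical_set_scope.
Local Open Scope ring_scope.
Local Open Scope cat_scope.

(** * Preadditive and abelian categories *)

(** Without projectives or injectives, Ext is only a set of Yoneda classes and no long exact
    sequence is at hand. Each one that the argument needs becomes a diagram construction about two
    elementary predicates: [split_ext A D], every extension of A by D splits (Ext^1 = 0), and
    [splice_split A D], every two-step extension comes from a filtered object (Ext^2 = 0).
    [split_ext] does not mention the exact subcategory: X^_n is closed under extensions, so its
    Ext^1 is that of the abelian category. Higher Ext relative to X^_n must be treated inside X^_n.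
    It is reduced to Ext^1 by syzygies, which stay in the left class because that class is closed
    under epikernels. For the pair with left class omega^_m this uses that omega^_n is closed under
    epikernels, the same hypothesis that gives the last case of thickness. The localization consists
    of words in morphisms and formal inverses, so a functor on it is a recursion on words, and
    naturality is proved by induction on words. *)

Section Preadditive.
Context {C : preadditive_category}.
Implicit Types A B D K T Z : C.

Lemma comp0m A B D (f : hom A B) : (0 : hom B D) \o f = 0.
Proof. by apply: (addrI ((0 : hom B D) \o f)); rewrite -compDl !addr0. Qed.

Lemma compm0 A B D (g : hom B D) : g \o (0 : hom A B) = 0.
Proof. by apply: (addrI (g \o (0 : hom A B))); rewrite -compDr !addr0. Qed.

Lemma compNm A B D (g : hom B D) (f : hom A B) : (- g) \o f = - (g \o f).
Proof. by apply: (addrI (g \o f)); rewrite -compDl !subrr comp0m. Qed.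

Lemma compmN A B D (g : hom B D) (f : hom A B) : g \o (- f) = - (g \o f).
Proof. by apply: (addrI (g \o f)); rewrite -compDr !subrr compm0. Qed.

Lemma compBl A B D (g g' : hom B D) (f : hom A B) :
  (g - g') \o f = (g \o f) - (g' \o f).
Proof. by rewrite compDl compNm. Qed.

Lemma compBr A B D (g : hom B D) (f f' : hom A B) :
  g \o (f - f') = (g \o f) - (g \o f').
Proof. by rewrite compDr compmN. Qed.

Lemma hom_from_zero Z A (f : hom Z A) : is_zero Z -> f = 0.
Proof. by move=> Z0; rewrite -[f]compm1 Z0 compm0. Qed.

Lemma hom_to_zero Z A (f : hom A Z) : is_zero Z -> f = 0.
Proof. by move=> Z0; rewrite -[f]comp1m Z0 comp0m. Qed.

Lemma monoP A B (f : hom A B) :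
  mono f <-> forall T (u : hom T A), f \o u = 0 -> u = 0.
Proof.
split=> [mf T u fu0|mf T u v fuv]; first by apply: mf; rewrite compm0.
by apply/subr0_eq/mf; rewrite compBr fuv subrr.
Qed.

Lemma epiP A B (f : hom A B) :
  epi f <-> forall T (u : hom B T), u \o f = 0 -> u = 0.
Proof.
split=> [ef T u fu0|ef T u v fuv]; first by apply: ef; rewrite comp0m.
by apply/subr0_eq/ef; rewrite compBl fuv subrr.
Qed.

Lemma kernel_mono A B K (f : hom A B) (k : hom K A) : is_kernel f k -> mono k.
Proof.
move=> [fk0 ker] T u v kuv.
have [|w [_ uw]] := ker _ (k \o u); first by rewrite compA fk0 comp0m.
by rewrite -(uw u) // -(uw v).
Qed.

Lemma cokernel_epi A B K (f : hom A B) (q : hom B K) :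
  is_cokernel f q -> epi q.
Proof.
move=> [qf0 coker] T u v kuv.
have [|w [_ uw]] := coker _ (u \o q); first by rewrite -compA qf0 compm0.
by rewrite -(uw u) // -(uw v).
Qed.

Lemma mono_kernel A B K (f : hom A B) (k : hom K A) :
  mono k -> f \o k = 0 ->
  (forall T (t : hom T A), f \o t = 0 -> exists u, k \o u = t) ->
  is_kernel f k.
Proof.
move=> mk fk0 ker; split=> // T t /ker [u ku].
by exists u; split=> // v kv; apply: mk; rewrite ku kv.
Qed.

Lemma mono_comp A B D (g : hom B D) (f : hom A B) :
  mono g -> mono f -> mono (g \o f).
Proof. by move=> mg mf T u v; rewrite -!compA => /mg /mf. Qed.

Lemma epi_comp A B D (g : hom B D) (f : hom A B) :
  epi g -> epi f -> epi (g \o f).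
Proof. by move=> eg ef T u v; rewrite !compA => /ef /eg. Qed.

Lemma mono_id A : mono (idm A).
Proof. by move=> T u v; rewrite !comp1m. Qed.

Lemma epi_id A : epi (idm A).
Proof. by move=> T u v; rewrite !compm1. Qed.

Definition is_pullback P B D' D (f' : hom P B) (p' : hom P D')
    (p : hom B D) (f : hom D' D) : Prop :=
  p \o f' = f \o p' /\
  forall T (u : hom T B) (v : hom T D'), p \o u = f \o v ->
    exists! w : hom T P, f' \o w = u /\ p' \o w = v.

Lemma pullback_sym P B D' D (f' : hom P B) (p' : hom P D')
    (p : hom B D) (f : hom D' D) :
  is_pullback f' p' p f -> is_pullback p' f' f p.
Proof.
move=> [sq univ]; split=> [//|T u v /esym/univ [w [[fw pw] uw]]].
by exists w; split=> // w' [] pw' fw'; apply: uw.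
Qed.

Lemma pullback_monic P B D' D (f' : hom P B) (p' : hom P D')
    (p : hom B D) (f : hom D' D) T (w w' : hom T P) :
  is_pullback f' p' p f -> f' \o w = f' \o w' -> p' \o w = p' \o w' -> w = w'.
Proof.
move=> [sq univ] fw pw.
have [|x [_ ux]] := univ _ (f' \o w) (p' \o w); first by rewrite !compA sq.
by rewrite -(ux w) // (ux w').
Qed.

Lemma pullback_kernel P B D' D (f' : hom P B) (p' : hom P D')
    (p : hom B D) (f : hom D' D) K (k : hom K B) :
  is_pullback f' p' p f -> is_kernel p k ->
  exists k', is_kernel p' k' /\ f' \o k' = k.
Proof.
move=> pb kk; have [pk0 ker] := kk; have [sq univ] := pb.
have [|k' [[fk' pk'] _]] := univ _ k (0 : hom K D').
  by rewrite pk0 compm0.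
exists k'; split=> //; apply: mono_kernel => // [T u v kuv|T t pt0].
  by apply: (kernel_mono kk); rewrite -fk' -!compA kuv.
have [|u [ku _]] := ker _ (f' \o t).
  by rewrite compA sq -compA pt0 compm0.
exists u; apply: (pullback_monic pb); first by rewrite compA fk'.
by rewrite compA pk' comp0m pt0.
Qed.

Lemma short_exact0 A B D (i : hom A B) (p : hom B D) :
  short_exact i p -> p \o i = 0.
Proof. by case=> [[]]. Qed.

Lemma short_exact_mono A B D (i : hom A B) (p : hom B D) :
  short_exact i p -> mono i.
Proof. by case=> /kernel_mono. Qed.

Lemma short_exact_epi A B D (i : hom A B) (p : hom B D) :
  short_exact i p -> epi p.
Proof. by case=> _ /cokernel_epi. Qed.

Lemma short_exact_lift A B D (i : hom A B) (p : hom B D) T (t : hom T B) :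
  short_exact i p -> p \o t = 0 -> exists u, i \o u = t.
Proof. by case=> -[_ ker] _ /ker [u [iu _]]; exists u. Qed.

Lemma short_exact_extend A B D (i : hom A B) (p : hom B D) T (t : hom B T) :
  short_exact i p -> t \o i = 0 -> exists u, u \o p = t.
Proof. by case=> _ [_ coker] /coker [u [up _]]; exists u. Qed.

End Preadditive.

(* A lemma is dualised by instantiating it at [opab C], which is possible only
   outside the section where it is proved; hence the short sections below. *)
Definition opcat (C : preadditive_category) : preadditive_category.
Proof.
refine (@PreadditiveCategory C (fun A B => hom B A) (@idm C)
  (fun _ _ _ g f => f \o g) _ _ _ _ _).
- by move=> A B f; rewrite compm1.
- by move=> A B f; rewrite comp1m.
- by move=> *; rewrite compA.
- by move=> *; rewrite compDr.
- by move=> *; rewrite compDl.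
Defined.

Definition opab (C : abelian_category) : abelian_category.
Proof.
refine (@AbelianCategory (opcat C) _ _ _ _ _ _).
- exact: (ab_zero C).
- move=> A B; have [S [i1 [i2 [p1 [p2 []]]]]] := @ab_biproduct C A B.
  by move=> *; exists S, p1, p2, i1, i2.
- by move=> A B f; apply: (@ab_cokernel C).
- by move=> A B f; apply: (@ab_kernel C).
- by move=> A B f ef; have := @ab_epi C _ _ _ ef.
- by move=> A B f ef; have := @ab_mono C _ _ _ ef.
Defined.

Section Abelian.
Context {C : abelian_category}.
Implicit Types A B D K T Z : C.

Lemma epi_kernel_short_exact A B K (f : hom A B) (k : hom K A) :
  epi f -> is_kernel f k -> short_exact k f.
Proof.
move=> /ab_epi[G [g [fg0 coker]]] [fk0 ker]; split=> //; split=> // T t tk0.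
have [u [ku _]] := ker _ _ fg0.
by apply: coker; rewrite -ku compA tk0 comp0m.
Qed.

Lemma epi_short_exact A B (f : hom A B) :
  epi f -> exists K (k : hom K A), short_exact k f.
Proof.
move=> ef; have [K [k kk]] := ab_kernel f.
by exists K, k; apply: epi_kernel_short_exact.
Qed.

(* P is the kernel of (p, - f) : B + D' -> D. *)
Lemma pullback_exists B D' D (p : hom B D) (f : hom D' D) :
  exists P (f' : hom P B) (p' : hom P D'), is_pullback f' p' p f.
Proof.
have [S [i1 [i2 [p1 [p2 [e11 e22 e12 e21 e]]]]]] := @ab_biproduct C B D'.
have [P [k kk]] := ab_kernel ((p \o p1) - (f \o p2)); have [k0 ker] := kk.
exists P, (p1 \o k), (p2 \o k); split=> [|T u v puv].
  by apply/subr0_eq; rewrite !compA -compBl.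
have [|w [kw uw]] := ker _ ((i1 \o u) + (i2 \o v)).
  rewrite compBl !compDr -!compA.
  rewrite !(compA p1) !(compA p2) e11 e12 e21 e22 !comp1m !comp0m.
  by rewrite !compm0 addr0 add0r puv subrr.
exists w; split=> [|w' [ew1 ew2]].
  rewrite -!compA kw !compDr !compA e11 e12 e21 e22.
  by rewrite !comp1m !comp0m addr0 add0r.
by apply: uw; rewrite -ew1 -ew2 !compA -!compDl e comp1m.
Qed.

(** P is the kernel of q = (p, - f) on B + D', and q is epi because it restricts to p on B; so q is
    a cokernel of P. If u kills p', then u after the second projection factors as v after q.
    Restricting to B gives v p = 0, so v = 0 and u = 0. *)
Lemma pullback_epi P B D' D (f' : hom P B) (p' : hom P D')
    (p : hom B D) (f : hom D' D) :
  is_pullback f' p' p f -> epi p -> epi p'.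
Proof.
move=> pb /epiP ep; apply/epiP => T u up0; have [sq univ] := pb.
have [S [i1 [i2 [p1 [p2 [e11 e22 e12 e21 e]]]]]] := @ab_biproduct C B D'.
pose q := (p \o p1) - (f \o p2).
have eq : epi q.
  apply/epiP => U v vq0; apply: ep.
  suff -> : p = q \o i1 by rewrite compA vq0 comp0m.
  by rewrite compBl -!compA e11 e21 compm0 subr0 compm1.
have [K [k se]] := epi_short_exact eq.
have [|t [[ft pt] _]] := univ _ (p1 \o k) (p2 \o k).
  by apply/subr0_eq; rewrite !compA -compBl; have := short_exact0 se.
have [|v vq] := short_exact_extend (t := u \o p2) se.
  by rewrite -compA -pt compA up0 comp0m.
have v0 : v = 0.
  apply: ep; suff -> : p = q \o i1 by rewrite compA vq -compA e21 compm0.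
  by rewrite compBl -!compA e11 e21 compm0 subr0 compm1.
by rewrite -[u]compm1 -e22 compA -vq v0 !comp0m.
Qed.

Lemma pullback_short_exact P B D' D (f' : hom P B) (p' : hom P D')
    (p : hom B D) (f : hom D' D) K (k : hom K B) :
  is_pullback f' p' p f -> short_exact k p ->
  exists k', short_exact k' p' /\ f' \o k' = k.
Proof.
move=> pb se; have [k' [kk' fk']] := pullback_kernel pb (proj1 se).
exists k'; split=> //; apply: epi_kernel_short_exact => //.
exact: pullback_epi pb (short_exact_epi se).
Qed.

(** Third isomorphism theorem: the kernel P of the composite is the preimage of A under f, built as
    a pullback, hence an extension of A by the kernel K of f. *)
Lemma short_exact_comp_epi K X B A D (k : hom K X) (f : hom X B)
    (i : hom A B) (p : hom B D) :
  short_exact k f -> short_exact i p ->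
  exists P (j : hom P X) (k' : hom K P) (f' : hom P A),
    [/\ short_exact j (p \o f), short_exact k' f', j \o k' = k
      & f \o j = i \o f'].
Proof.
move=> sf sp; have [P [j [f' pb]]] := pullback_exists f i.
have [k' [sk' jk']] := pullback_short_exact pb sf.
exists P, j, k', f'; split=> //; last by case: pb.
have [sq univ] := pb.
apply: epi_kernel_short_exact.
  exact: epi_comp (short_exact_epi sp) (short_exact_epi sf).
apply: mono_kernel => [T u v juv||T t pft].
- apply: (pullback_monic pb) => //; apply: (short_exact_mono sp).
  by rewrite !compA -sq -!compA juv.
- by rewrite -compA sq compA (short_exact0 sp) comp0m.
- have [|s is'] := short_exact_lift (t := f \o t) sp; first by rewrite compA.
  by have [w [[jw _] _]] := univ _ t s (esym is'); exists w.
Qed.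

End Abelian.

Section Duality.
Context {C : abelian_category}.
Implicit Types A B D K T Z : C.

Lemma mono_cokernel_short_exact A B Q (f : hom A B) (q : hom B Q) :
  mono f -> is_cokernel f q -> short_exact f q.
Proof.
by move=> mf cq; have [] := @epi_kernel_short_exact (opab C) _ _ _ f q mf cq.
Qed.

Lemma short_exact_op A B D (i : hom A B) (p : hom B D) :
  short_exact i p <-> @short_exact (opab C) D B A p i.
Proof. by split=> -[]; split. Qed.

Definition is_pushout P A A' B (p' : hom A' P) (f' : hom B P)
    (f : hom A A') (i : hom A B) : Prop :=
  p' \o f = f' \o i /\
  forall T (u : hom A' T) (v : hom B T), u \o f = v \o i ->
    exists! w : hom P T, w \o p' = u /\ w \o f' = v.

Lemma pushout_exists A A' B (f : hom A A') (i : hom A B) :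
  exists P (p' : hom A' P) (f' : hom B P), is_pushout p' f' f i.
Proof. exact: (@pullback_exists (opab C) A' B A f i). Qed.

Lemma pushout_sym P A A' B (p' : hom A' P) (f' : hom B P)
    (f : hom A A') (i : hom A B) :
  is_pushout p' f' f i -> is_pushout f' p' i f.
Proof. exact: (@pullback_sym (opab C)). Qed.

Lemma pushout_short_exact P A A' B (p' : hom A' P) (f' : hom B P)
    (f : hom A A') (i : hom A B) D (p : hom B D) :
  is_pushout p' f' f i -> short_exact i p ->
  exists q, short_exact p' q /\ q \o f' = p.
Proof.
move=> /pushout_sym po /short_exact_op se.
have [q [/short_exact_op sq qf]] :=
  @pullback_short_exact (opab C) _ _ _ _ _ _ _ _ _ _ po se.
by exists q.
Qed.

Lemma short_exact_comp_mono A B D X Q (i : hom A B) (p : hom B D)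
    (j : hom B X) (q : hom X Q) :
  short_exact i p -> short_exact j q ->
  exists S (c : hom X S) (q' : hom S Q) (j' : hom D S),
    [/\ short_exact (j \o i) c, short_exact j' q', q' \o c = q
      & c \o j = j' \o p].
Proof.
move=> /short_exact_op si /short_exact_op sj.
have [S [c [q' [j' [/short_exact_op ? /short_exact_op ? ? ?]]]]] :=
  short_exact_comp_epi sj si.
by exists S, c, q', j'.
Qed.

End Duality.

(** * Split extensions: the vanishing of Ext^1 *)

Section Splitting.
Context {C : abelian_category}.
Implicit Types A B D K N T Z S : C.

Definition split_ext A D : Prop :=
  forall B (i : hom D B) (p : hom B A),
    short_exact i p -> exists s, p \o s = idm A.

Lemma section_retraction A B D (i : hom D B) (p : hom B A) (s : hom A B) :
  short_exact i p -> p \o s = idm A -> exists r, is_biproduct i s r p.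
Proof.
move=> se ps; have [|r ir] := short_exact_lift (t := idm B - (s \o p)) se.
  by rewrite compBr compm1 compA ps comp1m subrr.
exists r; split=> //; last by rewrite ir subrK.
- apply: (short_exact_mono se); rewrite compA ir compBl comp1m compm1.
  by rewrite -compA (short_exact0 se) compm0 subr0.
- apply: (short_exact_mono se).
  by rewrite compA ir compBl comp1m -compA ps !compm1 subrr compm0.
- exact: short_exact0 se.
Qed.

Lemma biproduct_short_exact A B S (i1 : hom A S) (i2 : hom B S)
    (p1 : hom S A) (p2 : hom S B) :
  is_biproduct i1 i2 p1 p2 -> short_exact i1 p2.
Proof.
move=> [e11 e22 e12 e21 e]; apply: epi_kernel_short_exact.
  by move=> T u v /(congr1 (fun f => f \o i2)); rewrite -!compA e22 !compm1.
apply: mono_kernel => // [T u v /(congr1 (comp p1))|T t p2t].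
  by rewrite !compA e11 !comp1m.
by exists (p1 \o t); rewrite -[RHS]comp1m -e compDl -!compA p2t compm0 addr0.
Qed.

Lemma biproduct_sym A B S (i1 : hom A S) (i2 : hom B S)
    (p1 : hom S A) (p2 : hom S B) :
  is_biproduct i1 i2 p1 p2 -> is_biproduct i2 i1 p2 p1.
Proof. by move=> [? ? ? ? e]; split=> //; rewrite addrC. Qed.

(** The pullback of the extension along f is an extension of A by D; a section of it gives the
    lift. *)
Lemma split_ext_lift A D Z B (i : hom D Z) (p : hom Z B) (f : hom A B) :
  split_ext A D -> short_exact i p -> exists g, p \o g = f.
Proof.
move=> sAD se; have [P [f' [p' pb]]] := pullback_exists p f.
have [i' [se' _]] := pullback_short_exact pb se.
have [s ps] := sAD _ _ _ se'; exists (f' \o s).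
by case: pb => sq _; rewrite compA sq -compA ps compm1.
Qed.

End Splitting.

Section SplittingDuality.
Context {C : abelian_category}.
Implicit Types A B D K N T Z S : C.

Lemma retraction_section A B D (i : hom D B) (p : hom B A) (r : hom B D) :
  short_exact i p -> r \o i = idm D -> exists s, p \o s = idm A.
Proof.
move=> /short_exact_op se ri.
have [s [? _ _ _ _]] := @section_retraction (opab C) _ _ _ _ _ _ se ri.
by exists s.
Qed.

Lemma split_ext_op A D : split_ext A D <-> @split_ext (opab C) D A.
Proof.
split=> sAD B i p se; last first.
  have [r ri] := sAD _ _ _ ((short_exact_op i p).1 se).
  exact: retraction_section se ri.
move/short_exact_op in se; have [s ps] := sAD _ _ _ se.
by have [r [? _ _ _ _]] := section_retraction se ps; exists r.
Qed.

Lemma split_ext_extend A D K B (i : hom K B) (p : hom B A) (f : hom K D) :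
  split_ext A D -> short_exact i p -> exists g, g \o i = f.
Proof.
move=> /split_ext_op sAD /short_exact_op se.
exact: (@split_ext_lift (opab C) D A B K p i f sAD se).
Qed.

Lemma split_ext_of_retraction A D :
  (forall B (i : hom D B) (p : hom B A), short_exact i p ->
     exists r, r \o i = idm D) -> split_ext A D.
Proof.
move=> sAD; apply/split_ext_op.
by move=> B i p /short_exact_op/sAD.
Qed.

Lemma split_ext_retract A A' D (s : hom A' A) (r : hom A A') :
  r \o s = idm A' -> split_ext A D -> split_ext A' D.
Proof.
move=> rs sAD B i p se; have [g pg] := split_ext_lift r sAD se.
by exists (g \o s); rewrite compA pg.
Qed.

Lemma split_ext_zero Z D : is_zero Z -> split_ext Z D.
Proof.
by move=> Z0 B i p _; exists 0; rewrite compm0; apply/esym/hom_from_zero.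
Qed.

(** In an extension Z of B by N, the preimage P of A is an extension of A by N, so N is a retract of
    P. The retraction extends to Z because the quotient of Z by P is D. *)
Lemma split_ext_extension A B D N (i : hom A B) (p : hom B D) :
  short_exact i p -> split_ext A N -> split_ext D N -> split_ext B N.
Proof.
move=> se sA sD; apply: split_ext_of_retraction => Z j q sjq.
have [P [jP [k' [f' [sP sk' jk' _]]]]] := short_exact_comp_epi sjq se.
have [r rk] := split_ext_extend (idm N) sA sk'.
have [g gj] := split_ext_extend r sD sP.
by exists g; rewrite -jk' compA gj.
Qed.

End SplittingDuality.

(** * Splices of two extensions: the vanishing of Ext^2 *)

Section Splicing.
Context {C : abelian_category}.
Implicit Types A B D K N T Z S : C.

Lemma split_ext_retract_r A D D' (s : hom D' D) (r : hom D D') :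
  r \o s = idm D' -> split_ext A D -> split_ext A D'.
Proof.
move=> rs /split_ext_op sAD; apply/split_ext_op.
exact: (@split_ext_retract (opab C) _ _ _ r s rs sAD).
Qed.

Lemma split_ext_extension_r A B D N (i : hom A B) (p : hom B D) :
  short_exact i p -> split_ext N A -> split_ext N D -> split_ext N B.
Proof.
move=> /short_exact_op se /split_ext_op sA /split_ext_op sD.
by apply/split_ext_op; apply: split_ext_extension se sD sA.
Qed.

Lemma short_exact_id_zero A Z : is_zero Z ->
  short_exact (idm A) (0 : hom A Z).
Proof.
move=> Z0; apply: epi_kernel_short_exact.
  by apply/epiP => T u _; apply: hom_from_zero.
apply: mono_kernel => [||T t _]; [exact: mono_id | exact: comp0m |].
by exists t; rewrite comp1m.
Qed.

Lemma short_exact_zero_id A Z : is_zero Z ->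
  short_exact (0 : hom Z A) (idm A).
Proof.
move=> Z0; apply: epi_kernel_short_exact; first exact: epi_id.
apply: mono_kernel => [||T t]; [|exact: compm0|].
- by apply/monoP => T u _; apply: hom_to_zero.
- by rewrite comp1m => ->; exists 0; rewrite compm0.
Qed.

(* The splice of [i, p] and [k, q] is the zero class in Ext^2. *)
Definition splice_fill A B D K Z (i : hom D Z) (p : hom Z K)
    (k : hom K B) (q : hom B A) : Prop :=
  exists Zt (z : hom Z Zt) (b : hom Zt B),
    [/\ short_exact (z \o i) b, short_exact z (q \o b) & b \o z = k \o p].

Definition splice_split A D : Prop :=
  forall B K Z (i : hom D Z) (p : hom Z K) (k : hom K B) (q : hom B A),
    short_exact i p -> short_exact k q -> splice_fill i p k q.

(** The second condition of [splice_fill] follows from the other two. A map killed by z lifts to D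
    and vanishes there, so z is monic. The cokernel map c of z kills z i, so it factors through b,
    and then through q because p is epi; hence q b is a cokernel of z. *)
Lemma splice_short_exact A B D K Z Zt (i : hom D Z) (p : hom Z K)
    (k : hom K B) (q : hom B A) (z : hom Z Zt) (b : hom Zt B) :
  short_exact i p -> short_exact k q -> short_exact (z \o i) b ->
  b \o z = k \o p -> short_exact z (q \o b).
Proof.
move=> sip skq sb bz.
have mz : mono z.
  apply/monoP => T t zt0.
  have [|s is'] := short_exact_lift (t := t) sip.
    by apply: (short_exact_mono skq); rewrite compA -bz -compA zt0 !compm0.
  suff s0 : s = 0 by rewrite -is' s0 compm0.
  by apply: (short_exact_mono sb); rewrite -compA is' zt0 compm0.
have qbz : (q \o b) \o z = 0.
  by rewrite -compA bz compA (short_exact0 skq) comp0m.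
have [Q [c cc]] := ab_cokernel z; have sc := mono_cokernel_short_exact mz cc.
have cz := short_exact0 sc.
have [|c' c'b] := short_exact_extend (t := c) sb.
  by rewrite compA cz comp0m.
have [|c'' c''q] := short_exact_extend (t := c') skq.
  apply: (short_exact_epi sip).
  by rewrite -compA -bz compA c'b cz comp0m.
apply: mono_cokernel_short_exact => //; split=> // T t tz.
have [u uc] := short_exact_extend sc tz.
exists (u \o c''); split; first by rewrite -!compA (compA c'') c''q c'b.
move=> v vqb; apply: (epi_comp (short_exact_epi skq) (short_exact_epi sb)).
by rewrite vqb -!compA (compA c'') c''q c'b.
Qed.

(** A filling of the target pulls back along fB to a filling of the source. With the dual
    [splice_fill_pushout], this makes fillability invariant under the morphisms that generate Yoneda
    equivalence. *)
Lemma splice_fill_pullback A B D K Z (i : hom D Z) (p : hom Z K)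
    (k : hom K B) (q : hom B A) B' K' Z' (i' : hom D Z') (p' : hom Z' K')
    (k' : hom K' B') (q' : hom B' A)
    (fB : hom B B') (fK : hom K K') (fZ : hom Z Z') :
  short_exact i p -> short_exact k q ->
  fZ \o i = i' -> p' \o fZ = fK \o p -> fB \o k = k' \o fK ->
  splice_fill i' p' k' q' -> splice_fill i p k q.
Proof.
move=> sip skq fi fp fk [Z1 [z1 [b1 [s1 _ bz1]]]].
have [Zt [f' [b pb]]] := pullback_exists b1 fB.
have [j [sj fj]] := pullback_short_exact pb s1; have [sq univ] := pb.
have [|z [[fz bz] _]] := univ _ (z1 \o fZ) (k \o p).
  by rewrite !compA bz1 fk -!compA fp.
have zi : z \o i = j.
  apply: (pullback_monic pb); first by rewrite compA fz fj -compA fi.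
  by rewrite compA bz -compA (short_exact0 sip) compm0 (short_exact0 sj).
exists Zt, z, b; rewrite zi; split=> //.
by apply: (splice_short_exact sip skq) => //; rewrite zi.
Qed.

End Splicing.

Section SplicingOp.
Context {C : abelian_category}.
Implicit Types A B D K N T Z S : C.

Lemma splice_fill_op A B D K Z (i : hom D Z) (p : hom Z K)
    (k : hom K B) (q : hom B A) :
  splice_fill i p k q <-> @splice_fill (opab C) D Z A K B q k p i.
Proof.
split=> -[Zt [z [b [s1 s2 bz]]]]; exists Zt, b, z; split=> //;
  exact/short_exact_op.
Qed.

Lemma splice_split_op A D : splice_split A D -> @splice_split (opab C) D A.
Proof.
move=> h B K Z i p k q /short_exact_op sip /short_exact_op skq.
exact/splice_fill_op/h.
Qed.

End SplicingOp.

Section SplicingDuality.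
Context {C : abelian_category}.
Implicit Types A B D K N T Z S : C.

Lemma splice_fill_pushout A B D K Z (i : hom D Z) (p : hom Z K)
    (k : hom K B) (q : hom B A) B' K' Z' (i' : hom D Z') (p' : hom Z' K')
    (k' : hom K' B') (q' : hom B' A)
    (fB : hom B B') (fK : hom K K') (fZ : hom Z Z') :
  short_exact i' p' -> short_exact k' q' ->
  p' \o fZ = fK \o p -> fB \o k = k' \o fK -> q' \o fB = q ->
  splice_fill i p k q -> splice_fill i' p' k' q'.
Proof.
move=> /short_exact_op sip /short_exact_op skq fp fk fq /splice_fill_op h.
by apply/splice_fill_op; apply: (@splice_fill_pullback (opab C)
  _ _ _ _ _ _ _ _ _ _ _ _ _ _ _ _ fZ fK fB) h.
Qed.

(** This replaces exactness of Ext^1(N, B) -> Ext^1(N, D) -> Ext^2(N, A): a filling lifts an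
    extension of N by D to one of N by B, whose section is then pushed down. *)
Lemma split_ext_mono_cokernel A B D N (i : hom A B) (p : hom B D) :
  short_exact i p -> splice_split N A -> split_ext N B -> split_ext N D.
Proof.
move=> sip spl sB Z j q sjq.
have [Zt [z [b [_ sz bz]]]] := spl _ _ _ _ _ _ _ sip sjq.
by have [s ps] := sB _ _ _ sz; exists (b \o s); rewrite compA.
Qed.

End SplicingDuality.

Section Sums.
Context {C : abelian_category}.
Implicit Types A B D K N T Z S : C.

Lemma split_ext_epi_kernel A B D N (i : hom A B) (p : hom B D) :
  short_exact i p -> splice_split D N -> split_ext B N -> split_ext A N.
Proof.
move=> /short_exact_op sip /splice_split_op spl /split_ext_op sB.
by apply/split_ext_op; apply: split_ext_mono_cokernel sip spl sB.
Qed.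

Lemma biproduct_pair S A B T (i1 : hom A S) (i2 : hom B S)
    (p1 : hom S A) (p2 : hom S B) (u : hom T A) (v : hom T B) :
  is_biproduct i1 i2 p1 p2 -> exists w, p1 \o w = u /\ p2 \o w = v.
Proof.
move=> [e11 e22 e12 e21 e]; exists ((i1 \o u) + (i2 \o v)).
by rewrite !compDr !compA e11 e22 e12 e21 !comp0m !comp1m addr0 add0r.
Qed.

Lemma biproduct_copair S A B T (i1 : hom A S) (i2 : hom B S)
    (p1 : hom S A) (p2 : hom S B) (u : hom A T) (v : hom B T) :
  is_biproduct i1 i2 p1 p2 -> exists w, w \o i1 = u /\ w \o i2 = v.
Proof.
move=> [e11 e22 e12 e21 e]; exists ((u \o p1) + (v \o p2)).
by rewrite !compDl -!compA e11 e22 e12 e21 !compm0 !compm1 addr0 add0r.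
Qed.

Lemma short_exact_sum A B D A' B' D' (i : hom A B) (p : hom B D)
    (i' : hom A' B') (p' : hom B' D') SA SB SD
    (jA : hom A SA) (jA' : hom A' SA) (qA : hom SA A) (qA' : hom SA A')
    (jB : hom B SB) (jB' : hom B' SB) (qB : hom SB B) (qB' : hom SB B')
    (jD : hom D SD) (jD' : hom D' SD) (qD : hom SD D) (qD' : hom SD D') :
  is_biproduct jA jA' qA qA' -> is_biproduct jB jB' qB qB' ->
  is_biproduct jD jD' qD qD' -> short_exact i p -> short_exact i' p' ->
  exists (j : hom SA SB) (q : hom SB SD), short_exact j q.
Proof.
move=> bA bB bD s s'.
have [a11 a22 a12 a21 ea] := bA; have [b11 b22 b12 b21 eb] := bB.
have [d11 d22 d12 d21 ed] := bD.
exists ((jB \o i \o qA) + (jB' \o i' \o qA')).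
exists ((jD \o p \o qB) + (jD' \o p' \o qB')).
have uB T (u v : hom T SB) : qB \o u = qB \o v -> qB' \o u = qB' \o v -> u = v.
  move=> e1 e2; rewrite -[u]comp1m -[v]comp1m -eb !compDl -!compA.
  by rewrite e1 e2.
apply: epi_kernel_short_exact.
  apply/epiP => T u; rewrite compDr => u0.
  have u1 : u \o jD = 0.
    apply: (short_exact_epi s); rewrite comp0m.
    have /(congr1 (fun f => f \o jB)) := u0.
    rewrite compDl -!compA b11 b21 !compm0 addr0 compm1 comp0m.
    by rewrite compA.
  have u2 : u \o jD' = 0.
    apply: (short_exact_epi s'); rewrite comp0m.
    have /(congr1 (fun f => f \o jB')) := u0.
    rewrite compDl -!compA b12 b22 !compm0 add0r compm1 comp0m.
    by rewrite compA.
  by rewrite -[u]compm1 -ed compDr !compA u1 u2 !comp0m addr0.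
have qBj : qB \o ((jB \o i \o qA) + (jB' \o i' \o qA')) = i \o qA.
  by rewrite compDr !compA b11 b12 !comp0m addr0 comp1m.
have qBj' : qB' \o ((jB \o i \o qA) + (jB' \o i' \o qA')) = i' \o qA'.
  by rewrite compDr !compA b22 b21 !comp0m add0r comp1m.
apply: mono_kernel => [|| T t].
- move=> T u v e; have e1 : qA \o u = qA \o v.
    apply: (short_exact_mono s); by rewrite !compA -qBj -!(compA qB) e.
  have e2 : qA' \o u = qA' \o v.
    apply: (short_exact_mono s'); by rewrite !compA -qBj' -!(compA qB') e.
  by rewrite -[u]comp1m -[v]comp1m -ea !compDl -!compA e1 e2.
- rewrite compDl -!(compA _ qB) -!(compA _ qB') qBj qBj'.
  rewrite -!compA (compA p) (compA p') (short_exact0 s) (short_exact0 s').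
  by rewrite !comp0m !compm0 addr0.
rewrite compDl => t0.
have [|u iu] := short_exact_lift (t := qB \o t) s.
  have /(congr1 (comp qD)) := t0.
  by rewrite compDr compm0 !compA d11 d12 comp1m !comp0m addr0.
have [|u' iu'] := short_exact_lift (t := qB' \o t) s'.
  have /(congr1 (comp qD')) := t0.
  by rewrite compDr compm0 !compA d22 d21 comp1m !comp0m add0r.
have [w [w1 w2]] := biproduct_pair u u' bA.
exists w; apply: uB.
  by rewrite compA qBj -compA w1.
by rewrite compA qBj' -compA w2.
Qed.

End Sums.

(** * Yoneda extensions *)

Section Yoneda.
Context {C : abelian_category}.
Implicit Types (E Q : set C) (A B D K Z : C).

Lemma yext_mor_refl E j A D (e : yext E j A D) : yext_mor (idm A) (idm D) e e.
Proof.
elim: j A D e => [|j IH] A D /=.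
  by move=> e; exists (idm (ext_mid e)); rewrite !comp1m !compm1.
move=> [K [e1 e2]]; exists (idm K); split; last exact: IH.
by exists (idm (ext_mid e1)); rewrite !comp1m !compm1.
Qed.

Lemma yext_mor_equiv E j A D (e e' : yext E j A D) :
  yext_mor (idm A) (idm D) e e' -> yext_equiv e e'.
Proof. by move=> ee'; apply: rst_step. Qed.

Lemma yext_equiv_splice E j A D K (e : extension1 E A K) (f f' : yext E j K D) :
  yext_equiv f f' ->
  @yext_equiv C E j.+1 A D (existT _ K (e, f)) (existT _ K (e, f')).
Proof.
elim=> [{}f {}f' ff'|{}f|{}f {}f' _|f1 f2 f3 _ IH1 _ IH2].
- apply: yext_mor_equiv; exists (idm K); split=> //.
  exact: (@yext_mor_refl E 0).
- exact: rst_refl.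
- exact: rst_sym.
- exact: rst_trans IH2.
Qed.

Lemma yext_pullback E j A' A D (a : hom A' A) (e : yext E j A D) :
  closed_extensions E -> E A' ->
  exists e' : yext E j A' D, yext_mor a (idm D) e' e.
Proof.
move=> Eext EA'.
have pull K (e1 : extension1 E A K) :
    exists e1' : extension1 E A' K, extension1_mor a (idm K) e1' e1.
  case: e1 => B i p cf; have [EK _ _ se] := cf.
  have [P [f' [p' pb]]] := pullback_exists p a.
  have [i' [se' fi]] := pullback_short_exact pb se.
  have cf' : conflation E i' p' by split=> //; apply: Eext se' EK EA'.
  exists (Extension1 cf'), f'; rewrite /= compm1; split=> //.
  by case: pb.
case: j e => [|j] /= e; first exact: pull.
case: e => K [e1 e2]; have [e1' me] := pull _ e1.
exists (existT _ K (e1', e2)), (idm K); split=> //.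
exact: yext_mor_refl.
Qed.

Lemma yext_inhabited E j Z D :
  is_zero Z -> E Z -> E D -> exists e : yext E j Z D, True.
Proof.
move=> Z0 EZ ED; elim: j => [|j [e _]].
  have cf : conflation E (idm D) (0 : hom D Z).
    by split=> //; apply: short_exact_id_zero.
  by exists (Extension1 cf).
have cf : conflation E (0 : hom Z Z) (idm Z).
  by split=> //; apply: short_exact_zero_id.
by exists (existT _ Z (Extension1 cf, e)).
Qed.

Lemma Ext1_eq0_split E A D : split_ext A D -> Ext_eq0 E 1 A D.
Proof.
move=> sAD [B i p cf] [B' i' p' cf'].
have [_ _ _ se] := cf; have [_ _ _ se'] := cf'.
have [s ps] := sAD _ _ _ se; have [s' ps'] := sAD _ _ _ se'.
have [r [ri _ _ _ _]] := section_retraction se ps.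
apply: rst_step; exists ((i' \o r) + (s' \o p)) => /=.
rewrite compDl compDr -!compA ri (short_exact0 se) !compA ps'.
by rewrite (short_exact0 se') comp0m compm0 addr0 add0r.
Qed.

(** Having a section is invariant under the generators of Yoneda equivalence, in both directions, so
    it passes from the biproduct to every extension in its class. *)
Lemma split_Ext1_eq0 E A D :
  closed_extensions E -> E A -> E D -> Ext_eq0 E 1 A D -> split_ext A D.
Proof.
move=> Eext EA ED ext0 B i p se.
have cf : conflation E i p by split=> //; apply: Eext se ED EA.
have [S [i1 [i2 [p1 [p2 bS]]]]] := @ab_biproduct C D A.
have seS := biproduct_short_exact bS.
have cfS : conflation E i1 p2 by split=> //; apply: Eext seS ED EA.
pose P (e : yext E 0 A D) := exists s, ext_prj e \o s = idm A.
suff : P (Extension1 cfS) <-> P (Extension1 cf).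
  by case=> [h _]; apply: h; exists i2; case: bS.
elim: (ext0 (Extension1 cfS) (Extension1 cf)); try by rewrite /P; intuition.
move=> [B1 j1 q1 c1] [B2 j2 q2 c2] [b] /=.
have [_ _ _ s1] := c1; have [_ _ _ s2] := c2.
rewrite compm1 comp1m /P /= => -[bj qb]; split=> [[s qs]|[s qs]].
  by exists (b \o s); rewrite compA qb.
have [r [rj _ _ _ _]] := section_retraction s2 qs.
by apply: (retraction_section (r := r \o b) s1); rewrite -compA bj.
Qed.

(** Fillability is an invariant of the Yoneda class. The class e0 spliced through the zero object is
    filled by any extension of A by D, here by the biproduct. *)
Lemma splice_split_Ext2_eq0 A D : Ext_eq0 setT 2 A D -> splice_split A D.
Proof.
move=> ext0 B K Z i p k q sip skq.
have [O O0] := ab_zero C.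
have [S [i1 [i2 [p1 [p2 bS]]]]] := @ab_biproduct C D A.
have cf : conflation setT i p by [].
have cf' : conflation setT k q by [].
have cO : conflation setT (idm D) (0 : hom D O).
  by split=> //; apply: short_exact_id_zero.
have cO' : conflation setT (0 : hom O A) (idm A).
  by split=> //; apply: short_exact_zero_id.
pose P (e : yext setT 1 A D) := splice_fill (ext_inj (projT2 e).2)
  (ext_prj (projT2 e).2) (ext_inj (projT2 e).1) (ext_prj (projT2 e).1).
pose e0 : yext setT 1 A D := existT _ O (Extension1 cO', Extension1 cO).
pose e1 : yext setT 1 A D := existT _ K (Extension1 cf', Extension1 cf).
suff : P e0 <-> P e1.
  case=> + _; apply; exists S, i1, p2; rewrite /= compm1 comp1m.
  have se := biproduct_short_exact bS.
  by split=> //; rewrite compm0 (short_exact0 se).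
elim: (ext0 e0 e1); try by rewrite /P; intuition.
move=> [K1 [[B1 k1 q1 c1] [Z1 j1 r1 d1]]] [K2 [[B2 k2 q2 c2] [Z2 j2 r2 d2]]].
have [_ _ _ skq1] := c1; have [_ _ _ sjr1] := d1.
have [_ _ _ skq2] := c2; have [_ _ _ sjr2] := d2.
move=> [fK /= [[fB /= [fk fq]] [fZ /= [fj fr]]]].
rewrite comp1m in fq; rewrite compm1 in fj; rewrite /P /=; split.
  exact: (splice_fill_pushout (fB := fB) (fK := fK) (fZ := fZ)).
exact: (splice_fill_pullback (fB := fB) (fK := fK) (fZ := fZ)).
Qed.

(* The first term of a Yoneda extension of an object of Q may be replaced by an
   object of Q, which makes the first kernel lie in Q. *)
Lemma Ext_eq0_epikernels E Q D :
  closed_extensions E -> (forall Z, is_zero Z -> E Z) -> Q `<=` E ->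
  closed_epikernels Q ->
  (forall B, E B -> exists P (f : hom P B), Q P /\ epi f) ->
  E D -> (forall A, Q A -> split_ext A D) ->
  forall j A, Q A -> Ext_eq0 E j.+1 A D.
Proof.
move=> Eext E0 QE Qker Qcov ED sQD.
elim=> [|j IH] A QA; first exact/Ext1_eq0_split/sQD.
have [O O0] := ab_zero C; have EO := E0 _ O0.
have [eO _] := yext_inhabited j O0 EO ED.
have cO : conflation E (0 : hom O A) (idm A).
  by split=> //; [apply: QE | apply: QE | apply: short_exact_zero_id].
pose e0 : yext E j.+1 A D := existT _ O (Extension1 cO, eO).
suff all_e0 (e : yext E j.+1 A D) : yext_equiv e e0.
  by move=> e e'; apply: rst_trans (all_e0 e) _; apply/rst_sym/all_e0.
case: e => K [[B i p cf] f]; have [EK EB _ se] := cf.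
have [P [g [QP eg]]] := Qcov _ EB.
have [L [l sl]] := epi_short_exact eg.
have [K' [i' [_ [g' [se' _ _ gi]]]]] := short_exact_comp_epi sl se.
have QK' : Q K' by apply: Qker (short_exact_epi se') (proj1 se') QP QA.
have cf' : conflation E i' (p \o g) by split=> //; apply: QE.
have [f' mf'] := yext_pullback g' f Eext (QE _ QK').
(* f0 is pulled back along the zero map to O, so its splice maps to e0. By induction f' and f0 are
   equivalent, since K' is in Q. *)
have [f0 mf0] := yext_pullback (0 : hom K' O) eO Eext (QE _ QK').
apply: (@rst_trans _ _ _ (existT _ K' (Extension1 cf', f') : yext E j.+1 A D)).
  apply/rst_sym/yext_mor_equiv; exists g'; split=> //.
  by exists g => /=; rewrite comp1m.
apply: (@rst_trans _ _ _ (existT _ K' (Extension1 cf', f0) : yext E j.+1 A D)).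
  exact/yext_equiv_splice/IH.
apply: yext_mor_equiv; exists 0; split=> //.
exists (p \o g) => /=; rewrite compm0 !comp1m; split=> //.
exact: short_exact0 se'.
Qed.

End Yoneda.

(** * Resolutions and Auslander-Buchweitz approximation *)

Section Resolutions.
Context {C : abelian_category}.
Implicit Types (X : set C) (A B D K M Z : C).

(** The form of [hat] that peels off one syzygy at a time, so that induction on the length applies;
    see [hat_res]. *)
Fixpoint res X (n : nat) : set C :=
  if n is n'.+1 then
    [set M | exists K F (k : hom K F) (e : hom F M),
       [/\ short_exact k e, X F & res X n' K]]
  else X.

(** If u kills e, then e factors through the kernel j of u, and the cokernel of k j kills d, hence
    factors through q and kills k. So k factors through k j, which makes j a split epi and u
    zero. *)
Lemma image_factor_epi A B I Q (d : hom A B) (q : hom B Q) (k : hom I B)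
    (e : hom A I) :
  is_cokernel d q -> is_kernel q k -> d = k \o e -> epi e.
Proof.
move=> [_ coker] kk de; apply/epiP => T u ue0.
have [J [j kj]] := ab_kernel u; have [uj0 ker] := kj.
have [e' [je' _]] := ker _ _ ue0.
have mkj := mono_comp (kernel_mono kk) (kernel_mono kj).
have [G [g cg]] := ab_cokernel (k \o j).
have sg := mono_cokernel_short_exact mkj cg.
have [|g' [gq _]] := coker _ g.
  by rewrite de -je' !compA -(compA g) (short_exact0 sg) comp0m.
have [|s ks] := short_exact_lift (t := k) sg.
  by rewrite -gq -compA (proj1 kk) compm0.
rewrite -[u]compm1; suff <- : j \o s = idm I by rewrite compA uj0 comp0m.
by apply: (kernel_mono kk); rewrite compA ks compm1.
Qed.

Lemma hat_sub_res X n :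
  (forall A B (f : hom A B), mono f -> epi f -> X A -> X B) ->
  hat X n `<=` res X n.
Proof.
move=> Xiso; elim: n => [|n IH] M [F [d [e [XF F0 ee ex0 ex]]]].
  apply: (Xiso _ _ e) => //; last exact: XF.
  (* F 1 is zero in length 0, so q is the cokernel of a zero map and has a left inverse. Then k = 0,
     and e is monic as well as epi; this is why X must be closed under isomorphism. *)
  have [I [Q [k [q [[_ coker] [qk0 _] [_ ker]]]]]] := ex0.
  have d0 : d 0%N = 0 by apply: hom_from_zero; apply: F0.
  have [|u [uq _]] := coker _ (idm (F 0%N)); first by rewrite d0 compm0.
  apply/monoP => T t /ker[s [<- _]].
  by rewrite -[k]comp1m -uq -(compA u) qk0 compm0 comp0m.
have [I [Q [k [q [cq kq ke]]]]] := ex0.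
have [|e' [ke' _]] := (proj2 kq) _ (d 0%N); first exact: (proj1 cq).
exists I, (F 0%N), k, e; split; [exact: epi_kernel_short_exact | exact: XF |].
apply: IH; exists (fun i => F i.+1), (fun i => d i.+1), e'; split.
- by move=> i ni; apply: XF.
- by move=> i ni; apply: F0.
- exact: image_factor_epi cq kq (esym ke').
- have [I1 [Q1 [k1 [q1 [c1 kk1 [dk0 ker]]]]]] := ex 0%N.
  exists I1, Q1, k1, q1; split=> //; split.
    by apply: (kernel_mono kq); rewrite compA ke' dk0 compm0.
  by move=> T t et; apply: ker; rewrite -ke' -compA et compm0.
- by move=> i; apply: ex.
Qed.

Lemma res_sub_hat X n : res X n `<=` hat X n.
Proof.
have [O O0] := ab_zero C.
elim: n => [|n IH] M.
  move=> XM; pose F i := if i is 0%N then M else O.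
  exists F, (fun _ => 0), (idm M); split.
  - by case.
  - by case.
  - exact: epi_id.
  - have [k q] := short_exact_zero_id M O0.
    by exists O, M, 0, (idm M).
  - move=> i; exists O, O, (idm O), (idm O).
    have s1 := short_exact_zero_id O O0; have s2 := short_exact_id_zero O O0.
    split; first exact: (proj2 s1).
      by have := proj1 s2; rewrite -{1}O0.
    split; first exact: comp0m.
    by move=> T t _; exists t; split=> [|t' <-]; rewrite comp1m.
move=> [K [F0 [k [e [se XF /IH[F [d [e' [XF' F'0 ee' ex0 ex]]]]]]]]].
pose G i := if i is j.+1 then F j else F0.
pose dG i : hom (G i.+1) (G i) :=
  match i return hom (F i) (G i) with 0%N => k \o e' | j.+1 => d j end.
exists G, dG, e; split.
- by case.
- by case.
- exact: short_exact_epi se.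
- have [kk [ek0 coker]] := se; exists K, M, k, e; split=> //; split.
    by rewrite compA ek0 comp0m.
  move=> T t te; apply: coker; apply: ee'.
  by rewrite comp0m -compA.
- case=> [|i]; last exact: ex.
  have [I1 [Q1 [k1 [q1 [c1 kk1 [dk0 ker]]]]]] := ex0.
  exists I1, Q1, k1, q1; split=> //; split.
    by rewrite /= -compA dk0 compm0.
  move=> T t /= et; apply: ker; apply: (short_exact_mono se).
  by rewrite compm0 compA.
Qed.

Lemma hat_res X n :
  (forall A B (f : hom A B), mono f -> epi f -> X A -> X B) ->
  hat X n = res X n.
Proof.
move=> Xiso; rewrite eqEsubset; split; first exact: hat_sub_res.
exact: res_sub_hat.
Qed.

Lemma mono_epi_iso A B (f : hom A B) :
  mono f -> epi f -> exists g, g \o f = idm A /\ f \o g = idm B.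
Proof.
move=> /monoP mf ef; have [K [k se]] := epi_short_exact ef.
have k0 : k = 0 by apply/mf/(short_exact0 se).
have [|g gf] := short_exact_extend (t := idm A) se.
  by rewrite k0 compm0.
by exists g; split=> //; apply: ef; rewrite -compA gf compm1 comp1m.
Qed.

End Resolutions.

(** * Closure properties of the classes X^_n *)

Section AuslanderBuchweitz.
Context {C : abelian_category} (X Y : set C).
Implicit Types (A B D K L M N P Z : C) (n m : nat).
Context (XE : forall A, X A <-> forall D, Y D -> split_ext A D).
Context (YE : forall D, Y D <-> forall A, X A -> split_ext A D).
Context (XY_splice : forall A D, X A -> Y D -> splice_split A D).
Context (res_precover : forall n M, res X n M ->
  exists K A (k : hom K A) (p : hom A M), [/\ short_exact k p, X A & Y K]).
Context (res_preenvelope : forall n M, res X n M ->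
  exists D A (i : hom M D) (p : hom D A), [/\ short_exact i p, Y D & X A]).

Let XY A D : X A -> Y D -> split_ext A D.
Proof. by move=> /XE; apply. Qed.

Lemma left_class_retract A A' (s : hom A' A) (r : hom A A') :
  r \o s = idm A' -> X A -> X A'.
Proof.
by move=> rs XA; apply/XE => D YD; apply: split_ext_retract rs _; apply: XY.
Qed.

Lemma right_class_retract D D' (s : hom D' D) (r : hom D D') :
  r \o s = idm D' -> Y D -> Y D'.
Proof.
by move=> rs YD; apply/YE => A XA; apply: split_ext_retract_r rs _; apply: XY.
Qed.

Lemma left_class_extension A B D (i : hom A B) (p : hom B D) :
  short_exact i p -> X A -> X D -> X B.
Proof.
move=> se XA XD; apply/XE => N YN.
by apply: split_ext_extension se _ _; apply: XY.
Qed.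

Lemma right_class_extension A B D (i : hom A B) (p : hom B D) :
  short_exact i p -> Y A -> Y D -> Y B.
Proof.
move=> se YA YD; apply/YE => N XN.
by apply: split_ext_extension_r se _ _; apply: XY.
Qed.

Lemma left_class_epi_kernel A B D (i : hom A B) (p : hom B D) :
  short_exact i p -> X B -> X D -> X A.
Proof.
move=> se XB XD; apply/XE => N YN.
by apply: split_ext_epi_kernel se _ _; [apply: XY_splice | apply: XY].
Qed.

Lemma right_class_mono_cokernel A B D (i : hom A B) (p : hom B D) :
  short_exact i p -> Y A -> Y B -> Y D.
Proof.
move=> se YA YB; apply/YE => N XN.
by apply: split_ext_mono_cokernel se _ _; [apply: XY_splice | apply: XY].
Qed.

Lemma left_class_zero Z : is_zero Z -> X Z.
Proof. by move=> Z0; apply/XE => D _; apply: split_ext_zero. Qed.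

Lemma left_class_iso A B (f : hom A B) : mono f -> epi f -> X A -> X B.
Proof.
move=> mf ef; have [g [_ fg]] := mono_epi_iso mf ef.
exact: left_class_retract fg.
Qed.

Lemma res_succ n M : res X n M -> res X n.+1 M.
Proof.
elim: n M => [|n IH] M; last first.
  by move=> [K [F [k [e [se XF /IH rK]]]]]; exists K, F, k, e.
have [O O0] := ab_zero C; move=> XM; exists O, M, 0, (idm M).
by split=> //; [exact: short_exact_zero_id | exact: left_class_zero].
Qed.

Lemma res_leq m n : (m <= n)%N -> res X m `<=` res X n.
Proof.
move=> /subnK <-; elim: (n - m)%N => [//|d IH] M /IH rM.
exact: res_succ.
Qed.

Lemma res_of_X n : X `<=` res X n.
Proof. exact: (@res_leq 0). Qed.

Lemma res_kernel_to_X n K P F (k : hom K P) (p : hom P F) :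
  short_exact k p -> res X n P -> X F -> res X n K.
Proof.
move=> se; case: n => [|n]; first exact: left_class_epi_kernel se.
move=> [L [G [l [g [sg XG rL]]]]] XF.
have [H [h [l' [h' [sh sl _ _]]]]] := short_exact_comp_epi sg se.
by exists L, H, l', h'; split=> //; apply: left_class_epi_kernel sh XG XF.
Qed.

(** The two claims are proved together: at each length, closure under extensions implies that any
    kernel of a map from X onto M serves as a first syzygy ([step]), and closure at length n + 1
    uses that claim at length n. *)
Lemma res_extension_shift n :
  (forall A B D (i : hom A B) (p : hom B D),
    short_exact i p -> res X n A -> res X n D -> res X n B) /\
  (forall K F M (k : hom K F) (p : hom F M),
    short_exact k p -> X F -> res X n.+1 M -> res X n K).
Proof.
suff step n' : (forall A B D (i : hom A B) (p : hom B D),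
    short_exact i p -> res X n' A -> res X n' D -> res X n' B) ->
  forall K F M (k : hom K F) (p : hom F M),
    short_exact k p -> X F -> res X n'.+1 M -> res X n' K.
  suff ext : forall A B D (i : hom A B) (p : hom B D),
      short_exact i p -> res X n A -> res X n D -> res X n B.
    by split=> //; apply: step.
  elim: n => [|n IH] A B D i p se; first exact: left_class_extension se.
  move=> rA [KD [FD [k [e [sD XFD rKD]]]]].
  (* The given resolution of A is exchanged for a special precover, so that the syzygy KA lies in Y
     and Ext^2(FD, KA) vanishes; [step] returns KA to length n. *)
  have [KA [FA [kA [eA [sA XFA YKA]]]]] := res_precover rA.
  have rKA := step n IH _ _ _ _ _ sA XFA rA.
  have [P [f' [p' pb]]] := pullback_exists p e.
  have [i' [si' _]] := pullback_short_exact pb se.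
  have [k' [sk' _]] := pullback_short_exact (pullback_sym pb) sD.
  (* Ext^2(FD, KA) = 0 lifts P, an extension of FD by A, to one of FD by FA. *)
  have [Zt [z [b [s1 s2 _]]]] := XY_splice XFD YKA sA si'.
  (* Zt maps onto B through P, and the kernel L is an extension of KD by KA. *)
  have [L [l [kL [fL [sL sL' _ _]]]]] := short_exact_comp_epi s1 sk'.
  exists L, Zt, l, (f' \o b); split=> //.
    exact: left_class_extension s2 XFA XFD.
  exact: IH sL' rKA rKD.
move=> ext K F M k p se XF [K0 [F0 [k0 [e0 [se0 XF0 rK0]]]]].
(* Schanuel's argument: P is an extension of F by K0 and also of F0 by K. *)
have [P [f' [p' pb]]] := pullback_exists e0 p.
have [i' [si' _]] := pullback_short_exact pb se0.
have [k' [sk' _]] := pullback_short_exact (pullback_sym pb) se.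
exact: res_kernel_to_X sk' (ext _ _ _ _ _ si' rK0 (res_of_X n' XF)) XF0.
Qed.

Lemma res_extension n A B D (i : hom A B) (p : hom B D) :
  short_exact i p -> res X n A -> res X n D -> res X n B.
Proof. exact: (proj1 (res_extension_shift n)). Qed.

Lemma res_shift n K F M (k : hom K F) (p : hom F M) :
  short_exact k p -> X F -> res X n.+1 M -> res X n K.
Proof. exact: (proj2 (res_extension_shift n)). Qed.

Lemma res_cokernel n L P M (i : hom L P) (p : hom P M) :
  short_exact i p -> res X n L -> res X n.+1 P -> res X n.+1 M.
Proof.
move=> se rL [K [F [k [e [sF XF rK]]]]].
have [H [h [k' [h' [sh sk' _ _]]]]] := short_exact_comp_epi sF se.
exists H, F, h, (p \o e); split=> //; exact: res_extension sk' rK rL.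
Qed.

(** Let F in X cover B with kernel L. The kernel H of F -> D has length n by shifting, and K is the
    quotient of H by L, so [res_cokernel] applies. *)
Lemma res_epi_kernel n K B D (k : hom K B) (p : hom B D) :
  short_exact k p -> res X n B -> res X n D -> res X n K.
Proof.
case: n => [|n] se; first exact: left_class_epi_kernel se.
move=> [L [F [l [e [sF XF rL]]]]] rD.
have [H [h [l' [h' [sh sl _ _]]]]] := short_exact_comp_epi sF se.
apply: res_cokernel sl rL _; apply: res_succ; exact: res_shift sh XF rD.
Qed.

Lemma res_epikernels n : closed_epikernels (res X n).
Proof.
move=> K B D k p ep kk; exact: res_epi_kernel (epi_kernel_short_exact ep kk).
Qed.

(** The auxiliary bound N supplies resolutions of both summands. Their sum covers S, so shifting
    puts the sum of the two syzygies in length m - 1. The induction ends at X, which is closed under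
    retracts. *)
Lemma res_summand m (N : nat) M M' S (i1 : hom M S) (i2 : hom M' S)
    (p1 : hom S M) (p2 : hom S M') :
  is_biproduct i1 i2 p1 p2 -> res X N M -> res X N M' -> res X m S ->
  res X m M.
Proof.
elim: m N M M' S i1 i2 p1 p2 => [|m IH] N M M' S i1 i2 p1 p2 bS.
  by move=> _ _ XS; case: bS => e _ _ _ _; apply: left_class_retract e XS.
case: N => [XM _ _|N rM rM' rS]; first exact: res_of_X.
have [K [F [k [e [se XF rK]]]]] := rM.
have [K' [F' [k' [e' [se' XF' rK']]]]] := rM'.
have [SK [iK [iK' [pK [pK' bK]]]]] := ab_biproduct K K'.
have [SF [iF [iF' [pF [pF' bF]]]]] := ab_biproduct F F'.
have [j [q sjq]] := short_exact_sum bK bF bS se se'.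
have XSF : X SF := left_class_extension (biproduct_short_exact bF) XF XF'.
exists K, F, k, e; split=> //.
exact: IH bK rK rK' (res_shift sjq XSF rS).
Qed.

Let omega := X `&` Y.

(** Y is closed under cokernels of monomorphisms, which gives one inclusion. For the other, the
    special precover of an M in Y has its middle term in Y too, hence in omega, and its kernel is a
    shorter instance. *)
Lemma res_core n : res omega n = res X n `&` Y.
Proof.
rewrite eqEsubset; split=> M.
  elim: n M => [//|n IH] M [K [F [k [e [se [XF YF] /IH [rK YK]]]]]].
  by split; [exists K, F, k, e | apply: right_class_mono_cokernel se YK YF].
elim: n M => [//|n IH] M [rM YM].
have [K [F [k [e [se XF YK]]]]] := res_precover rM.
exists K, F, k, e; split=> //.
  by split=> //; apply: right_class_extension se YK YM.
by apply: IH; split=> //; apply: res_shift se XF rM.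
Qed.

Lemma core_iso A B (f : hom A B) : mono f -> epi f -> omega A -> omega B.
Proof.
move=> mf ef; have [g [_ fg]] := mono_epi_iso mf ef.
move=> [XA YA]; split; first exact: left_class_retract fg XA.
exact: right_class_retract fg YA.
Qed.

Lemma res_core_preenvelope n M : res X n M ->
  exists D A (i : hom M D) (p : hom D A),
    [/\ short_exact i p, res omega n D & X A].
Proof.
move=> rM; have [D [A [i [p [se YD XA]]]]] := res_preenvelope rM.
exists D, A, i, p; split=> //; rewrite res_core; split=> //.
exact: res_extension se rM (res_of_X n XA).
Qed.

End AuslanderBuchweitz.

(** * Cotorsion pairs and the Hovey triple *)

Section CotorsionPairs.
Context {C : abelian_category}.
Implicit Types (E P V X Y : set C) (A B D K M : C).

Lemma rperpi1_split E P D : closed_extensions E -> P `<=` E ->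
  rperpi E 1 P D <-> E D /\ forall A, P A -> split_ext A D.
Proof.
move=> Eext PE; split=> -[ED h]; split=> // A PA.
  by apply: split_Ext1_eq0 Eext (PE _ PA) ED (h A PA).
exact/Ext1_eq0_split/h.
Qed.

Lemma lperpi1_split E V A : closed_extensions E -> V `<=` E ->
  lperpi E 1 V A <-> E A /\ forall D, V D -> split_ext A D.
Proof.
move=> Eext VE; split=> -[EA h]; split=> // D VD.
  by apply: split_Ext1_eq0 Eext EA (VE _ VD) (h D VD).
exact/Ext1_eq0_split/h.
Qed.

Lemma cotorsion_pair_split E P V :
  closed_extensions E -> cotorsion_pair E P V ->
  (forall A, P A <-> E A /\ forall D, V D -> split_ext A D) /\
  (forall D, V D <-> E D /\ forall A, P A -> split_ext A D).
Proof.
move=> Eext [PV VP].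
have PE : P `<=` E by rewrite VP => A [].
have VE : V `<=` E by rewrite -PV => A [].
split=> M.
  rewrite {1}VP; split=> [/(lperpi1_split _ Eext VE)//|h].
  exact/lperpi1_split.
rewrite -{1}PV; split=> [/(rperpi1_split _ Eext PE)//|h].
exact/rperpi1_split.
Qed.

Lemma cotorsion_pair_extensions E P V :
  closed_extensions E -> cotorsion_pair E P V ->
  closed_extensions P /\ closed_extensions V.
Proof.
move=> Eext /(cotorsion_pair_split Eext)[PE VE].
split=> A B D i p se.
  move=> /PE[EA sA] /PE[ED sD]; apply/PE; split; first exact: Eext se EA ED.
  by move=> N VN; apply: split_ext_extension se (sA _ VN) (sD _ VN).
move=> /VE[EA sA] /VE[ED sD]; apply/VE; split; first exact: Eext se EA ED.
by move=> N PN; apply: split_ext_extension_r se (sA _ PN) (sD _ PN).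
Qed.

Lemma cotorsion_pair_zero E P V Z :
  closed_extensions E -> cotorsion_pair E P V -> E Z -> is_zero Z -> P Z /\ V Z.
Proof.
move=> Eext /(cotorsion_pair_split Eext)[PE VE] EZ Z0; split.
  by apply/PE; split=> // D _; apply: split_ext_zero.
apply/VE; split=> // A _; apply/split_ext_op.
exact: (@split_ext_zero (opab C)).
Qed.

Lemma special_precoverP E P V M : cotorsion_pair E P V ->
  special_precover E P M ->
  exists K A (k : hom K A) (p : hom A M), [/\ conflation E k p, P A & V K].
Proof.
by move=> [PV _] [K [A [k [p [cf PA VK]]]]]; rewrite -PV; exists K, A, k, p.
Qed.

Lemma special_preenvelopeP E P V M : cotorsion_pair E P V ->
  special_preenvelope E V M ->
  exists D A (i : hom M D) (p : hom D A), [/\ conflation E i p, V D & P A].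
Proof.
by move=> [_ PV] [D [A [i [p [cf VD PA]]]]]; rewrite PV; exists D, A, i, p.
Qed.

Definition summand_closed E P : Prop :=
  forall A B S (i1 : hom A S) (i2 : hom B S) (p1 : hom S A) (p2 : hom S B),
    is_biproduct i1 i2 p1 p2 -> E A -> E B -> P S -> P A.

(** An object orthogonal to P splits off its own approximation, hence is a summand of an object of
    V; dually on the other side. *)
Lemma complete_cotorsion_pair_of_approximations E P V :
  closed_extensions E -> P `<=` E -> V `<=` E ->
  summand_closed E P -> summand_closed E V ->
  (forall A D, P A -> V D -> split_ext A D) ->
  (forall M, E M -> exists K A (k : hom K A) (p : hom A M),
     [/\ short_exact k p, P A & V K]) ->
  (forall M, E M -> exists D A (i : hom M D) (p : hom D A),
     [/\ short_exact i p, V D & P A]) ->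
  complete_cotorsion_pair E P V.
Proof.
move=> Eext PE VE Psum Vsum PV pre env.
have PVr D : V D -> rperpi E 1 P D.
  by move=> VD; apply/(rperpi1_split _ Eext PE); split=> [|A PA];
    [apply: VE | apply: PV].
have PVl A : P A -> lperpi E 1 V A.
  by move=> PA; apply/(lperpi1_split _ Eext VE); split=> [|D VD];
    [apply: PE | apply: PV].
split.
  split; rewrite eqEsubset; split=> // M.
    move=> /(rperpi1_split _ Eext PE)[EM sM].
    have [D [A [i [p [se VD PA]]]]] := env _ EM.
    have [s ps] := sM _ PA _ _ _ se; have [r bD] := section_retraction se ps.
    by apply: Vsum bD EM (PE _ PA) VD.
  move=> /(lperpi1_split _ Eext VE)[EM sM].
  have [K [A [k [p [se PA VK]]]]] := pre _ EM.
  have [s ps] := sM _ VK _ _ _ se; have [r bA] := section_retraction se ps.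
  by apply: Psum (biproduct_sym bA) EM (VE _ VK) PA.
move=> M EM; split.
  have [K [A [k [p [se PA VK]]]]] := pre _ EM.
  exists K, A, k, p; split=> //; last exact: PVr.
  by split=> //; [apply: VE | apply: PE].
have [D [A [i [p [se VD PA]]]]] := env _ EM.
exists D, A, i, p; split=> //; last exact: PVl.
by split=> //; [apply: VE | apply: PE].
Qed.

End CotorsionPairs.

(** * Verification of the Hovey triple in X^_n *)

Section HoveyTriple.
Context {C : abelian_category} (X Y V : set C) (m n : nat).
Implicit Types (A B D K L M N P Z : C).
Context (XE : forall A, X A <-> forall D, Y D -> split_ext A D).
Context (YE : forall D, Y D <-> forall A, X A -> split_ext A D).
Context (XY_splice : forall A D, X A -> Y D -> splice_split A D).
Context (res_precover : forall n M, res X n M ->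
  exists K A (k : hom K A) (p : hom A M), [/\ short_exact k p, X A & Y K]).
Context (res_preenvelope : forall n M, res X n M ->
  exists D A (i : hom M D) (p : hom D A), [/\ short_exact i p, Y D & X A]).

Let omega := X `&` Y.

Context (PE : forall A, res omega m A <-> forall D, V D -> split_ext A D).
Context (VE : forall D, V D <-> forall A, res omega m A -> split_ext A D).
Context (V_precover : forall M, exists K A (k : hom K A) (p : hom A M),
  [/\ short_exact k p, res omega m A & V K]).
Context (V_preenvelope : forall M, exists D A (i : hom M D) (p : hom D A),
  [/\ short_exact i p, V D & res omega m A]).
Context (le_mn : (m <= n)%N) (epiker : closed_epikernels (res omega n)).

Let E := res X n.
Let Q := res X m.
Let W := res omega n.
Let R := V `&` E.

Let core k : res omega k = res X k `&` Y :=
  res_core XE YE XY_splice res_precover k.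

Let Eext : closed_extensions E.
Proof. by move=> A B D i p; apply: res_extension. Qed.

Let Qext : closed_extensions Q.
Proof. by move=> A B D i p; apply: res_extension. Qed.

Let QE : Q `<=` E.
Proof. exact: res_leq. Qed.

Let epikernels k : closed_epikernels (res X k).
Proof. exact: (res_epikernels XE XY_splice res_precover). Qed.

Let Yext : closed_extensions Y.
Proof. by move=> A B D i p; apply: (right_class_extension XE YE). Qed.

Lemma res_zero Z : is_zero Z -> E Z.
Proof. by move=> Z0; apply: (res_of_X XE); apply: left_class_zero XE _ Z0. Qed.

Lemma res_wic : wic_exact_subcategory E.
Proof.
split=> [||K B D k r s EB ED rs kk]; [exact: res_zero | exact: Eext |].
apply: epikernels kk EB ED.
by move=> T u v /(congr1 (fun f => f \o s)); rewrite -!compA rs !compm1.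
Qed.

Lemma QW_core : Q `&` W = res omega m.
Proof.
rewrite eqEsubset /W !core; split=> M; first by move=> [QM [_ YM]].
by move=> [QM YM]; split=> //; split=> //; apply: QE.
Qed.

(** W is the part of E in Y, so summands, cokernels and extensions are inherited from Y. Kernels are
    exactly the hypothesis on omega^_n. *)
Let W_thick : thick E W.
Proof.
rewrite /W core; split=> [M []//|A B S i1 i2 p1 p2 bS EA EB [_ YS]|].
  by split=> //; case: bS => e _ _ _ _; apply: (right_class_retract XE YE) e YS.
move=> A B D i p [EA EB ED se]; split=> [[_ YA] [_ YB]|[_ YA] [_ YD]|].
- by split=> //; apply: (right_class_mono_cokernel XE YE XY_splice) se YA YB.
- by split=> //; apply: Yext se YA YD.
- by rewrite -core; apply: epiker (short_exact_epi se) (proj1 se).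
Qed.

Let P_sub_E : res omega m `<=` E.
Proof. by rewrite core => M [QM _]; apply: QE. Qed.

(* A embeds in H in omega^_m with cokernel F in X; Ext^1(H, D) and Ext^2(F, D)
   vanish. *)
Lemma split_Q_WR A D : Q A -> W D -> V D -> split_ext A D.
Proof.
move=> QA WD VD; have YD : Y D by move: WD; rewrite /W core => -[].
have [H [F [i [p [se rH XF]]]]] :=
  res_core_preenvelope XE YE XY_splice res_precover res_preenvelope QA.
apply: split_ext_epi_kernel se _ _; first exact: XY_splice.
by move/PE: rH; apply.
Qed.

Lemma WR_preenvelope M : E M ->
  exists D A (i : hom M D) (p : hom D A),
    [/\ short_exact i p, (W `&` R) D & Q A].
Proof.
move=> EM; have [H [F [i [p [se rH XF]]]]] :=
  res_core_preenvelope XE YE XY_splice res_precover res_preenvelope EM.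
have [D [A [j [q [sj VD rA]]]]] := V_preenvelope H.
have [S [c [q' [j' [s1 s2 _ _]]]]] := short_exact_comp_mono se sj.
(* D is an extension of A by H, and both lie in E and in Y. The cokernel S of M in D is an extension
   of A by F, hence lies in Q. *)
have WD : W D.
  move: rH rA; rewrite /W !core => -[EH YH] [QA YA].
  split; first exact: Eext sj EH (QE QA).
  exact: Yext sj YH YA.
exists D, S, (j \o i), c; split=> //.
  by split=> //; split=> //; case: W_thick => h _ _; apply: h.
apply: Qext s2 _ _; first exact: (res_of_X XE).
by move: rA; rewrite core => -[].
Qed.

Lemma WR_precover M : E M ->
  exists K A (k : hom K A) (p : hom A M),
    [/\ short_exact k p, Q A & (W `&` R) K].
Proof.
move=> EM; have [K [F [k [p [se XF YK]]]]] := res_precover EM.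
have EF := res_of_X XE n XF.
have EK : E K by apply: epikernels (short_exact_epi se) (proj1 se) EF EM.
have [D [A [i [q [si WRD QA]]]]] := WR_preenvelope EK.
(* P is an extension of M by D and of A by F; the latter puts it in Q. *)
have [P [j [f po]]] := pushout_exists i k.
have [p' [sj _]] := pushout_short_exact po se.
have [q' [sf _]] := pushout_short_exact (pushout_sym po) si.
exists D, P, j, p'; split=> //; apply: Qext sf _ QA; exact: (res_of_X XE).
Qed.

Lemma R_preenvelope M : E M -> exists D A (i : hom M D) (p : hom D A),
  [/\ short_exact i p, R D & (Q `&` W) A].
Proof.
move=> EM; have [D [A [i [p [se VD PA]]]]] := V_preenvelope M.
exists D, A, i, p; rewrite QW_core; split=> //; split=> //.
exact: Eext se EM (P_sub_E PA).
Qed.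

Lemma split_QW_R A D : (Q `&` W) A -> R D -> split_ext A D.
Proof. by rewrite QW_core => /PE PA [VD _]; apply: PA. Qed.

Lemma QW_precover M : E M ->
  exists K A (k : hom K A) (p : hom A M),
    [/\ short_exact k p, (Q `&` W) A & R K].
Proof.
move=> EM; have [K [A [k [p [se PA VK]]]]] := V_precover M.
exists K, A, k, p; rewrite QW_core; split=> //; split=> //.
exact: epikernels (short_exact_epi se) (proj1 se) (P_sub_E PA) EM.
Qed.

Lemma R_summand : summand_closed E R.
Proof.
move=> A B S i1 i2 p1 p2 [e _ _ _ _] EA _ [VS _]; split=> //.
by apply/VE => D PD; apply: split_ext_retract_r e _; move/VE: VS; apply.
Qed.

Lemma res_hovey_triple : hovey_triple E Q W R.
Proof.
split; first exact: W_thick.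
  apply: complete_cotorsion_pair_of_approximations => //.
  - by rewrite QW_core.
  - by move=> M [].
  - rewrite QW_core => A B S i1 i2 p1 p2 [e _ _ _ _] _ _ PS.
    by apply/PE => D VD; apply: split_ext_retract e _; move/PE: PS; apply.
  - exact: R_summand.
  - exact: split_QW_R.
  - exact: QW_precover.
  - exact: R_preenvelope.
apply: complete_cotorsion_pair_of_approximations => //.
- by move=> M [_ []].
- move=> A B S i1 i2 p1 p2 bS.
  exact: (res_summand XE XY_splice res_precover bS).
- move=> A B S i1 i2 p1 p2 bS EA EB [WS RS]; split.
    by case: W_thick => _ h _; apply: h bS EA EB WS.
  exact: R_summand bS EA EB RS.
- by move=> A D QA [WD [VD _]]; apply: split_Q_WR.
- exact: WR_precover.
- exact: WR_preenvelope.
Qed.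

(** Both left classes are closed under epikernels and cover E, so all higher Ext relative to E
    reduces to splitting. *)
Lemma res_hereditary_hovey_triple : hereditary_hovey_triple E Q W R.
Proof.
split; first exact: res_hovey_triple.
  move=> A D [//|j] QWA RD _.
  apply: (Ext_eq0_epikernels Eext res_zero (Q := Q `&` W)) => //.
  - by move=> M [/QE].
  - move=> K B G k p ep kk [QB WB] [QG WG]; split.
      exact: epikernels ep kk QB QG.
    exact: epiker ep kk WB WG.
  - move=> B EB; have [K [P [k [p [se QWP RK]]]]] := QW_precover EB.
    by exists P, p; split=> //; apply: short_exact_epi se.
  - by case: RD.
  - by move=> B QWB; apply: split_QW_R.
move=> A D [//|j] QA [WD RD] _.
apply: (Ext_eq0_epikernels Eext res_zero (Q := Q)) => //.
- exact: epikernels.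
- move=> B EB; have [K [P [k [p [se QP RK]]]]] := WR_precover EB.
  by exists P, p; split=> //; apply: short_exact_epi se.
- by case: RD.
- by move=> B QB; case: RD => VD _; apply: split_Q_WR.
Qed.

End HoveyTriple.

(** * The homotopy category *)

Section CategoryTheory.
Context {A : category}.

#[export] Instance meq_equivalence (X Y : A) : Equivalence (@meq A X Y).
Proof.
split; [exact: meq_refl | exact: meq_sym | exact: meq_trans].
Qed.

#[export] Instance mcomp_proper (X Y Z : A) :
  Proper (meq ==> meq ==> meq) (@mcomp A X Y Z).
Proof. by move=> g g' gg f f' ff; apply: mcomp_meq. Qed.

(** It turns a naturality square at s into one at an inverse of s; for the second square, only
    one-sided inverses are needed. *)
Lemma inverse_square (X Y X' Y' : A) (s : mor X Y) (s' : mor Y X)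
    (g : mor X' Y') (g' : mor Y' X') (e : mor X X') (d : mor Y Y') :
  meq (mcomp s s') (mid Y) -> meq (mcomp g' g) (mid X') ->
  meq (mcomp g e) (mcomp d s) -> meq (mcomp g' d) (mcomp e s').
Proof.
move=> ss gg ge; rewrite -[d]mcompm1 -ss [mcomp d _]mcompA -ge.
rewrite mcompA mcompA gg mcomp1m; exact: meq_refl.
Qed.

Lemma iso_comp (X Y Z : A) (g : mor Y Z) (f : mor X Y) :
  is_iso g -> is_iso f -> is_iso (mcomp g f).
Proof.
move=> [g' [g1 g2]] [f' [f1 f2]]; exists (mcomp f' g'); split.
  rewrite -mcompA (mcompA g') g1 mcomp1m; exact: f1.
rewrite -mcompA (mcompA f) f2 mcomp1m; exact: g2.
Qed.

End CategoryTheory.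

(** * Bifibrant replacements and homotopies *)

Section Homotopy.
Context {C : abelian_category} (E Q W R : set C).
Implicit Types (K L M N P Z : C).
Context (E_ext : closed_extensions E) (E_zero : forall Z, is_zero Z -> E Z).
Context (hovey : hovey_triple E Q W R) (Q_epikernels : closed_epikernels Q).

Let cot1 : cotorsion_pair E (Q `&` W) R. Proof. by case: hovey => _ []. Qed.
Let cot2 : cotorsion_pair E Q (W `&` R). Proof. by case: hovey => _ _ []. Qed.

Let Q_E : Q `<=` E.
Proof. by move=> M /(proj1 (cotorsion_pair_split E_ext cot2))[]. Qed.

Let R_E : R `<=` E.
Proof. by move=> M /(proj2 (cotorsion_pair_split E_ext cot1))[]. Qed.

Let split1 A D : (Q `&` W) A -> R D -> split_ext A D.
Proof. by move=> /(proj1 (cotorsion_pair_split E_ext cot1))[_]; apply. Qed.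

Let split2 A D : Q A -> (W `&` R) D -> split_ext A D.
Proof. by move=> /(proj1 (cotorsion_pair_split E_ext cot2))[_]; apply. Qed.

Let QW_ext : closed_extensions (Q `&` W).
Proof. by case: (cotorsion_pair_extensions E_ext cot1). Qed.

Let R_ext : closed_extensions R.
Proof. by case: (cotorsion_pair_extensions E_ext cot1). Qed.

Let Q_ext : closed_extensions Q.
Proof. by case: (cotorsion_pair_extensions E_ext cot2). Qed.

Let WR_ext : closed_extensions (W `&` R).
Proof. by case: (cotorsion_pair_extensions E_ext cot2). Qed.

Let QW_zero Z : is_zero Z -> (Q `&` W) Z.
Proof. by move=> Z0; case: (cotorsion_pair_zero E_ext cot1 (E_zero Z0) Z0). Qed.

Let WR_zero Z : is_zero Z -> (W `&` R) Z.
Proof. by move=> Z0; case: (cotorsion_pair_zero E_ext cot2 (E_zero Z0) Z0). Qed.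

Let Q_precover M : E M ->
  exists K A (k : hom K A) (p : hom A M),
    [/\ conflation E k p, Q A & (W `&` R) K].
Proof.
move=> EM; case: hovey => _ _ [_ /(_ _ EM)[h _]].
exact: special_precoverP cot2 h.
Qed.

Let R_preenvelope M : E M ->
  exists D A (i : hom M D) (p : hom D A),
    [/\ conflation E i p, R D & (Q `&` W) A].
Proof.
move=> EM; case: hovey => _ [_ /(_ _ EM)[_ h]] _.
exact: special_preenvelopeP cot1 h.
Qed.

Let T := trivially_bifibrant Q W R.

Let T_ext : closed_extensions T.
Proof.
move=> A B D i p se [QWA RA] [QWD RD].
by split; [apply: QW_ext se _ _ | apply: R_ext se _ _].
Qed.

Definition homotopic M N (f g : hom M N) : Prop := factors_through T (f - g).

Lemma homotopic_refl M N (f : hom M N) : homotopic f f.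
Proof.
have [O O0] := ab_zero C; exists O, 0, 0; split; last by rewrite subrr compm0.
by split; [apply: QW_zero | case: (WR_zero O0)].
Qed.

Lemma homotopic_sym M N (f g : hom M N) : homotopic f g -> homotopic g f.
Proof.
move=> [Z [u [v [TZ e]]]]; exists Z, u, (- v); split=> //.
by rewrite compNm -e opprB.
Qed.

Lemma homotopic_trans M N (f g h : hom M N) :
  homotopic f g -> homotopic g h -> homotopic f h.
Proof.
move=> [Z [u [v [TZ e]]]] [Z' [u' [v' [TZ' e']]]].
have [S [i1 [i2 [p1 [p2 bS]]]]] := ab_biproduct Z Z'.
exists S, ((i1 \o u) + (i2 \o u')), ((v \o p1) + (v' \o p2)); split.
  exact: T_ext (biproduct_short_exact bS) TZ TZ'.
case: bS => e11 e22 e12 e21 _; rewrite -(subrKA g) e e' !compDl !compDr -!compA.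
rewrite !(compA p1) !(compA p2) e11 e12 e21 e22 !comp1m !comp0m !compm0.
by rewrite addr0 add0r.
Qed.

Lemma homotopic_comp M N P (g g' : hom N P) (f f' : hom M N) :
  homotopic g g' -> homotopic f f' -> homotopic (g \o f) (g' \o f').
Proof.
move=> [Z [u [v [TZ e]]]] [Z' [u' [v' [TZ' e']]]].
apply: (@homotopic_trans _ _ _ (g' \o f)).
  by exists Z, (u \o f), v; rewrite -compBl e compA.
by exists Z', u', (g' \o v'); rewrite -compBr e' compA.
Qed.

(* M <- cof -> bif: a cofibrant replacement of M by a trivial fibration,
   followed by a fibrant one by a trivial cofibration. *)
Record bifibrant_replacement M := BifibrantReplacement {
  cof : C;
  bif : C;
  rep_p : hom cof M;
  rep_i : hom cof bif;
  rep_p_fib : trivial_fibration E W R rep_p;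
  rep_i_cof : trivial_cofibration E Q W rep_i;
  cof_Q : Q cof;
  bif_R : R bif
}.

Lemma bif_Q M (a : bifibrant_replacement M) : Q (bif a).
Proof.
have [D [p [[_ _ _ se] [QD _]]]] := rep_i_cof a.
exact: Q_ext se (cof_Q a) QD.
Qed.

Lemma bifibrant_replacement_exists M :
  E M -> exists a : bifibrant_replacement M, True.
Proof.
move=> EM; have [K [A [k [p [cf QA WRK]]]]] := Q_precover EM.
have [D [B [i [q [cf' RD QWB]]]]] := R_preenvelope (Q_E QA).
have fib : trivial_fibration E W R p by exists K, k.
have cofib : trivial_cofibration E Q W i by exists B, q.
by exists (BifibrantReplacement fib cofib QA RD).
Qed.

Lemma trivial_fibration_id M : E M -> trivial_fibration E W R (idm M).
Proof.
move=> EM; have [O O0] := ab_zero C; exists O, 0; split; last exact: WR_zero.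
by split=> //; [apply: E_zero | apply: short_exact_zero_id].
Qed.

Lemma trivial_cofibration_id M : E M -> trivial_cofibration E Q W (idm M).
Proof.
move=> EM; have [O O0] := ab_zero C; exists O, 0; split; last exact: QW_zero.
by split=> //; [apply: E_zero | apply: short_exact_id_zero].
Qed.

Lemma trivial_fibration_comp M N P (g : hom N P) (f : hom M N) :
  trivial_fibration E W R g -> trivial_fibration E W R f ->
  trivial_fibration E W R (g \o f).
Proof.
move=> [L [l [[EL EN EP sl] WRL]]] [K [k [[EK EM _ sk] WRK]]].
have [H [h [k' [f' [sh sk' _ _]]]]] := short_exact_comp_epi sk sl.
exists H, h; split; last exact: WR_ext sk' _ _.
by split=> //; apply: E_ext sk' _ _.
Qed.

Lemma trivial_cofibration_comp M N P (g : hom N P) (f : hom M N) :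
  trivial_cofibration E Q W g -> trivial_cofibration E Q W f ->
  trivial_cofibration E Q W (g \o f).
Proof.
move=> [L [l [[EN EP EL sl] QWL]]] [K [k [[EM _ EK sk] QWK]]].
have [S [c [q' [j' [sh sk' _ _]]]]] := short_exact_comp_mono sk sl.
exists S, c; split; last exact: QW_ext sk' _ _.
by split=> //; apply: E_ext sk' _ _.
Qed.

(** A relation rather than a chosen lift: it composes strictly, while chosen lifts compose only up
    to homotopy. *)
Definition lifts M N (a : bifibrant_replacement M) (b : bifibrant_replacement N)
    (f : hom M N) (g : hom (bif a) (bif b)) : Prop :=
  exists h : hom (cof a) (cof b),
    rep_p b \o h = f \o rep_p a /\ rep_i b \o h = g \o rep_i a.

Arguments lifts {M N} a b f g.

Lemma lifts_exists M N (a : bifibrant_replacement M)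
    (b : bifibrant_replacement N) (f : hom M N) :
  exists g, lifts a b f g.
Proof.
have [K [k [[_ _ _ sk] WRK]]] := rep_p_fib b.
have [D [p [[_ _ _ sp] QWD]]] := rep_i_cof a.
have [h ph] := split_ext_lift (f \o rep_p a) (split2 (cof_Q a) WRK) sk.
have [g gi] := split_ext_extend (rep_i b \o h) (split1 QWD (bif_R b)) sp.
by exists g, h.
Qed.

Lemma lifts_id M (a : bifibrant_replacement M) :
  lifts a a (idm M) (idm (bif a)).
Proof. by exists (idm (cof a)); rewrite !comp1m !compm1. Qed.

Lemma lifts_comp M N P (a : bifibrant_replacement M)
    (b : bifibrant_replacement N) (c : bifibrant_replacement P)
    (f' : hom N P) (f : hom M N) g' g :
  lifts b c f' g' -> lifts a b f g -> lifts a c (f' \o f) (g' \o g).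
Proof.
move=> [h' [p' i']] [h [p i]]; exists (h' \o h).
by rewrite !compA p' i' -!compA p i.
Qed.

(** u lifts to a special Q-precover P of Z, and P stays in W and R as an extension of Z by its
    kernel; so P is in T. *)
Lemma factors_through_WR A Z B (u : hom A Z) (v : hom Z B) :
  Q A -> (W `&` R) Z -> factors_through T (v \o u).
Proof.
move=> QA WRZ; have EZ : E Z by case: WRZ => _ /R_E.
have [K [P [k [p [[_ _ _ se] QP WRK]]]]] := Q_precover EZ.
have [s ps] := split_ext_lift u (split2 QA WRK) se.
exists P, s, (v \o p); rewrite -compA ps; split=> //.
have [WP RP] := WR_ext se WRK WRZ.
by split.
Qed.

Lemma factors_through_QW A Z B (u : hom A Z) (v : hom Z B) :
  R B -> (Q `&` W) Z -> factors_through T (v \o u).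
Proof.
move=> RB QWZ; have EZ : E Z by case: QWZ => /Q_E.
have [D [P [i [p [[_ _ _ se] RD QWP]]]]] := R_preenvelope EZ.
have [s si] := split_ext_extend v (split1 QWP RB) se.
exists D, (i \o u), s; rewrite compA si; split=> //.
by split=> //; apply: QW_ext se QWZ QWP.
Qed.

(* Two choices of h differ by a map through the kernel of [rep_p b]; then two
   choices of g differ, up to this, by a map through the cokernel of
   [rep_i a]. *)
Lemma lifts_unique M N (a : bifibrant_replacement M)
    (b : bifibrant_replacement N) (f : hom M N) g g' :
  lifts a b f g -> lifts a b f g' -> homotopic g g'.
Proof.
move=> [h [ph ih]] [h' [ph' ih']].
have [K [k [[_ _ _ sk] WRK]]] := rep_p_fib b.
have [D [p [[_ _ _ sp] QWD]]] := rep_i_cof a.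
have [|u ku] := short_exact_lift (t := h - h') sk.
  by rewrite compBr ph ph' subrr.
have [u' ui] := split_ext_extend u (split1 QWD (proj2 WRK)) sp.
apply: (@homotopic_trans _ _ _ (g - (rep_i b \o k \o u'))).
  by rewrite /homotopic subKr; apply: factors_through_WR (bif_Q a) WRK.
have [|w wp] := short_exact_extend (t := g - (rep_i b \o k \o u') - g') sp.
  by rewrite !compBl -ih -ih' -!compA
    ui ku compBr subKr subrr.
by rewrite /homotopic -wp; apply: factors_through_QW (bif_R b) QWD.
Qed.

Definition homotopy_equivalence M N (g : hom M N) : Prop :=
  exists g', homotopic (g' \o g) (idm M) /\ homotopic (g \o g') (idm N).

Lemma homotopy_equivalence_homotopic M N (g g' : hom M N) :
  homotopic g g' -> homotopy_equivalence g -> homotopy_equivalence g'.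
Proof.
move=> gg [k [kg gk]]; exists k; split.
  apply: homotopic_trans kg; apply: homotopic_comp; first exact: homotopic_refl.
  exact: homotopic_sym.
apply: homotopic_trans gk; apply: homotopic_comp; last exact: homotopic_refl.
exact: homotopic_sym.
Qed.

Lemma homotopy_equivalence_comp M N P (g : hom N P) (f : hom M N) :
  homotopy_equivalence g -> homotopy_equivalence f ->
  homotopy_equivalence (g \o f).
Proof.
move=> [g' [gg1 gg2]] [f' [ff1 ff2]]; exists (f' \o g'); split.
  apply: homotopic_trans ff1; rewrite -compA; apply: homotopic_comp.
    exact: homotopic_refl.
  rewrite -[f in homotopic _ f]comp1m compA; apply: homotopic_comp => //.
  exact: homotopic_refl.
apply: homotopic_trans gg2; rewrite -compA; apply: homotopic_comp.
  exact: homotopic_refl.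
rewrite -[g' in homotopic _ g']comp1m compA; apply: homotopic_comp => //.
exact: homotopic_refl.
Qed.

Lemma lifts_id_equivalence M (a b : bifibrant_replacement M) g :
  lifts a b (idm M) g -> homotopy_equivalence g.
Proof.
move=> lg; have [g' lg'] := lifts_exists b a (idm M); exists g'; split.
  apply: lifts_unique (lifts_id a).
  by have := lifts_comp lg' lg; rewrite comp1m.
apply: lifts_unique (lifts_id b).
by have := lifts_comp lg lg'; rewrite comp1m.
Qed.

(** Whether s lifts to a homotopy equivalence does not depend on the replacements, so it may be
    tested on a convenient pair, for which the lift is an identity in the uses below. *)
Lemma lifts_equivalence M N (a c : bifibrant_replacement M)
    (b d : bifibrant_replacement N) (s : hom M N) u g :
  lifts c d s u -> homotopy_equivalence u -> lifts a b s g ->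
  homotopy_equivalence g.
Proof.
move=> lu eu lg.
have [v lv] := lifts_exists a c (idm M).
have [w lw] := lifts_exists d b (idm N).
apply: (@homotopy_equivalence_homotopic _ _ (w \o (u \o v))).
  apply: lifts_unique lg; have := lifts_comp lw (lifts_comp lu lv).
  by rewrite comp1m compm1.
apply: homotopy_equivalence_comp; first exact: lifts_id_equivalence lw.
by apply: homotopy_equivalence_comp => //; apply: lifts_id_equivalence lv.
Qed.

Lemma homotopy_equivalence_id M : homotopy_equivalence (idm M).
Proof. by exists (idm M); rewrite comp1m; split; apply: homotopic_refl. Qed.

Lemma trivial_fibration_equivalence M N (a : bifibrant_replacement M)
    (b : bifibrant_replacement N) (s : hom M N) g :
  trivial_fibration E W R s -> lifts a b s g -> homotopy_equivalence g.
Proof.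
move=> ts lg; pose d := BifibrantReplacement
  (trivial_fibration_comp ts (rep_p_fib a)) (rep_i_cof a) (cof_Q a) (bif_R a).
apply: (lifts_equivalence (c := a) (d := d) (u := idm (bif a))) lg.
  by exists (idm (cof a)); rewrite !compm1 comp1m.
exact: homotopy_equivalence_id.
Qed.

(* Pulling back the cofibrant replacement of N along s yields one of M. *)
Lemma trivial_cofibration_equivalence M N (a : bifibrant_replacement M)
    (b : bifibrant_replacement N) (s : hom M N) g :
  trivial_cofibration E Q W s -> lifts a b s g -> homotopy_equivalence g.
Proof.
move=> [D [p [[EM EN ED se] QWD]]] lg.
have [K [k [[EK Ecb _ sk] WRK]]] := rep_p_fib b.
have [P [f [k' [f' [sP sk' _ ff]]]]] := short_exact_comp_epi sk se.
have QP : Q P.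
  by apply: Q_epikernels (short_exact_epi sP) (proj1 sP) (cof_Q b) (proj1 QWD).
have fib : trivial_fibration E W R f'.
  by exists K, k'; split=> //; split=> //; apply: Q_E.
have cofib : trivial_cofibration E Q W f.
  by exists D, (p \o rep_p b); split=> //; split=> //; apply: Q_E.
pose c := BifibrantReplacement fib
  (trivial_cofibration_comp (rep_i_cof b) cofib) QP (bif_R b).
apply: (lifts_equivalence (c := c) (d := b) (u := idm (bif b))) lg.
  by exists f; rewrite comp1m.
exact: homotopy_equivalence_id.
Qed.

Lemma weak_equivalence_equivalence M N (a : bifibrant_replacement M)
    (b : bifibrant_replacement N) (s : hom M N) g :
  weak_equivalence E Q W R s -> lifts a b s g -> homotopy_equivalence g.
Proof.
move=> [Z [i [p [ti tp ->]]]] lg.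
have EZ : E Z by case: ti => D [q [[]]].
have [c _] := bifibrant_replacement_exists EZ.
have [gi li] := lifts_exists a c i; have [gp lp] := lifts_exists c b p.
apply: (@homotopy_equivalence_homotopic _ _ (gp \o gi)).
  exact: lifts_unique (lifts_comp lp li) lg.
apply: homotopy_equivalence_comp.
  exact: trivial_fibration_equivalence tp lp.
exact: trivial_cofibration_equivalence ti li.
Qed.

Definition bifibrant_replacement_id M (QM : Q M) (RM : R M) :
    bifibrant_replacement M :=
  BifibrantReplacement (trivial_fibration_id (Q_E QM))
    (trivial_cofibration_id (Q_E QM)) QM RM.

(** * The localization and the quotient of the bifibrant objects *)

Let CE := full_subcategory E.
Let weq (M N : CE) : hom (sval M) (sval N) -> Prop :=
  @weak_equivalence C E Q W R (sval M) (sval N).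
Let Ho := homotopy_category E Q W R.

Definition replacement (M : CE) : bifibrant_replacement (sval M) :=
  sval (cid (bifibrant_replacement_exists (svalP M))).

Definition lift_hom (M N : CE) (f : hom (sval M) (sval N)) :
    hom (bif (replacement M)) (bif (replacement N)) :=
  sval (cid (lifts_exists (replacement M) (replacement N) f)).

Lemma liftP (M N : CE) (f : hom (sval M) (sval N)) :
  lifts (replacement M) (replacement N) f (lift_hom f).
Proof. by rewrite /lift_hom; case: cid. Qed.

Definition lift_inverse (M N : CE) (s : hom (sval M) (sval N)) (ws : weq s) :=
  sval (cid (weak_equivalence_equivalence ws (liftP s))).

Lemma lift_inverseP (M N : CE) (s : hom (sval M) (sval N)) (ws : weq s) :
  homotopic (lift_inverse ws \o lift_hom s) (idm _) /\
  homotopic (lift_hom s \o lift_inverse ws) (idm _).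
Proof. by rewrite /lift_inverse; case: cid. Qed.

Fixpoint loc_lift (M N : CE) (l : loc_mor weq M N) :
    hom (bif (replacement M)) (bif (replacement N)) :=
  match l with
  | loc_of _ _ f => lift_hom f
  | loc_inv _ _ _ ws => lift_inverse ws
  | loc_comp _ _ _ l1 l2 => loc_lift l1 \o loc_lift l2
  end.

Lemma lift_id (M : CE) : homotopic (lift_hom (idm (sval M))) (idm _).
Proof. exact: lifts_unique (liftP _) (lifts_id _). Qed.

Lemma lift_comp (M N P : CE) (g : hom (sval N) (sval P))
    (f : hom (sval M) (sval N)) :
  homotopic (lift_hom (g \o f)) (lift_hom g \o lift_hom f).
Proof. exact: lifts_unique (liftP _) (lifts_comp (liftP _) (liftP _)). Qed.

(** Each defining relation of the localization becomes a homotopy: those on identities and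
    composites by uniqueness of lifts, those on formal inverses by the choice of homotopy
    inverses. *)
Lemma loc_lift_eq (M N : CE) (l l' : loc_mor weq M N) :
  loc_eq l l' -> homotopic (loc_lift l) (loc_lift l').
Proof.
elim=> {M N l l'} /=.
- by move=> M N l; apply: homotopic_refl.
- by move=> M N l l' _; apply: homotopic_sym.
- by move=> M N l l' l'' _ h _; apply: homotopic_trans.
- by move=> M N P l1 l1' l2 l2' _ h1 _ h2; apply: homotopic_comp.
- move=> M N l; rewrite -[X in homotopic _ X]comp1m.
  by apply: homotopic_comp (lift_id _) (homotopic_refl _).
- move=> M N l; rewrite -[X in homotopic _ X]compm1.
  by apply: homotopic_comp (homotopic_refl _) (lift_id _).
- by move=> M N P S l1 l2 l3; rewrite compA; apply: homotopic_refl.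
- by move=> M N f g ->; apply: homotopic_refl.
- by move=> M N P g f; apply: lift_comp.
- move=> M N s ws; apply: homotopic_trans (homotopic_sym (lift_id _)).
  by have [] := lift_inverseP ws.
- move=> M N s ws; apply: homotopic_trans (homotopic_sym (lift_id _)).
  by have [] := lift_inverseP ws.
Qed.

Lemma trivial_fibration_weq M N (f : hom M N) :
  trivial_fibration E W R f -> weak_equivalence E Q W R f.
Proof.
move=> tf; exists M, (idm M), f; rewrite compm1; split=> //.
by case: tf => K [k [[_ EM _ _] _]]; apply: trivial_cofibration_id.
Qed.

Lemma trivial_cofibration_weq M N (f : hom M N) :
  trivial_cofibration E Q W f -> weak_equivalence E Q W R f.
Proof.
move=> tf; exists N, f, (idm N); rewrite comp1m; split=> //.
by case: tf => K [k [[_ EN _ _] _]]; apply: trivial_fibration_id.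
Qed.

Lemma loc_of_congr (M N : CE) (f f' : hom (sval M) (sval N)) :
  f = f' -> loc_eq (loc_of weq f : loc_mor weq M N) (loc_of weq f').
Proof. by move=> ->; apply: loc_refl. Qed.

(* With S = M + Z, both (1, u) and (1, 0) are sections of the weak equivalence
   S -> M, hence agree in the localization. *)
Lemma homotopic_loc_eq (M N : CE) (f g : hom (sval M) (sval N)) :
  homotopic f g -> @loc_eq CE weq M N (loc_of weq f) (loc_of weq g).
Proof.
move=> [Z [u [v [[[QZ WZ] RZ] fg]]]].
have [S [i1 [i2 [p1 [p2 bS]]]]] := ab_biproduct Z (sval M).
have se := biproduct_short_exact bS; have EZ := Q_E QZ.
have ES := E_ext se EZ (svalP M); pose S' : CE := exist _ S ES.
have wp : weq (p2 : @mor CE S' M).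
  apply: trivial_fibration_weq; exists Z, i1.
  by split=> //; split=> //; apply: (svalP M).
have [w [w1 w2]] := biproduct_pair u (idm (sval M)) bS.
(* c sends the section (1, u) to g + v u = f and the section (1, 0) to g. *)
have [c [c1 c2]] := biproduct_copair v g bS.
have ew : @loc_eq CE weq M S' (loc_of weq (w : @mor CE M S'))
    (loc_of weq (i2 : @mor CE M S')).
  have sec (t : @mor CE M S') : p2 \o t = idm (sval M) ->
      @loc_eq CE weq M S' (loc_of weq t) (loc_inv wp).
    move=> p2t; apply: loc_trans (loc_sym (loc_comp1m _)) _.
    apply: loc_trans (loc_comp_eq (loc_sym (loc_invl wp)) (loc_refl _)) _.
    apply: loc_trans (loc_sym (loc_compA _ _ _)) _.
    apply: loc_trans (loc_compm1 _); apply: loc_comp_eq; first exact: loc_refl.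
    have e := @loc_of_comp CE weq M S' M p2 t.
    exact: loc_trans (loc_sym e) (@loc_of_congr M M _ _ p2t).
  apply: loc_trans (sec _ w2) (loc_sym (sec _ _)).
  by case: bS.
have cw : c \o w = f.
  case: bS => _ _ _ _ e; rewrite -[w]comp1m -e compDl -!compA w1 w2 compDr.
  by rewrite !compA c1 c2 compm1 -fg subrK.
rewrite -cw -c2.
have e1 := @loc_of_comp CE weq M S' N c w.
have e2 := @loc_of_comp CE weq M S' N c i2.
exact: loc_trans e1 (loc_trans (loc_comp_eq (loc_refl _) ew) (loc_sym e2)).
Qed.

Let BC := full_subcategory (Q `&` R).

Lemma homotopic_congruence : congruence (@ideal_rel C (Q `&` R) T).
Proof.
split=> /=.
- by move=> M N f g ->; apply: homotopic_refl.
- by move=> M N f g; apply: homotopic_sym.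
- by move=> M N f g h; apply: homotopic_trans.
- by move=> M N P g g' f f'; apply: homotopic_comp.
Qed.

Context (cT : congruence (@ideal_rel C (Q `&` R) T)).

Let qBC := quotient_category cT.

Definition bifibrant_object (M : CE) : BC :=
  exist (Q `&` R) (bif (replacement M)) (conj (bif_Q _) (bif_R _)).

Definition inclusion_object (M : BC) : CE :=
  exist E (sval M) (Q_E (proj1 (svalP M))).

Definition replacement_functor : functor Ho qBC.
Proof.
refine (@Functor Ho qBC bifibrant_object loc_lift _ _ _).
- exact: loc_lift_eq.
- exact: lift_id.
- by move=> M N P g f; apply: homotopic_refl.
Defined.

Definition inclusion_functor : functor qBC Ho.
Proof.
refine (@Functor qBC Ho inclusion_object (fun (M N : qBC) g =>
  loc_of weq (g : @mor CE (inclusion_object M) (inclusion_object N))) _ _ _).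
- move=> M N f g.
  exact: (@homotopic_loc_eq (inclusion_object M) (inclusion_object N) f g).
- by move=> M; apply: loc_refl.
- move=> M N P g f.
  exact: (@loc_of_comp CE weq (inclusion_object M) (inclusion_object N)
    (inclusion_object P) g f).
Defined.

Lemma homotopy_category_equivalence : equivalent_categories Ho qBC.
Proof.
have wp (M : CE) : @weak_equivalence C E Q W R _ _ (rep_p (replacement M)).
  exact: trivial_fibration_weq (rep_p_fib _).
have wi (M : CE) : @weak_equivalence C E Q W R _ _ (rep_i (replacement M)).
  exact: trivial_cofibration_weq (rep_i_cof _).
pose cofo (M : CE) : CE := exist E (cof (replacement M)) (Q_E (cof_Q _)).
pose F := replacement_functor; pose G := inclusion_functor.
pose p (M : CE) : @mor CE (cofo M) M := rep_p (replacement M).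
pose i (M : CE) : @mor CE (cofo M) (G (F M)) := rep_i (replacement M).
pose p' (M : CE) : @mor Ho M (cofo M) :=
  @loc_inv CE weq (cofo M) M (p M) (wp M).
pose i' (M : CE) : @mor Ho (G (F M)) (cofo M) :=
  @loc_inv CE weq (cofo M) (G (F M)) (i M) (wi M).
pose L (M N : CE) (f : @mor CE M N) : @mor Ho M N := loc_of weq f.
(* The zigzag M <- cof -> bif read in the localization, where both legs are invertible. *)
pose eta (M : Ho) : @mor Ho M (G (F M)) := mcomp (L _ _ (i M)) (p' M).
pose triv (M : qBC) : bifibrant_replacement (sval M) :=
  bifibrant_replacement_id (proj1 (svalP M)) (proj2 (svalP M)).
(* The counit lifts the identity from the chosen replacement of a bifibrant object to its identity
   replacement; as a lift of an identity it is a homotopy equivalence. *)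
have [eps epsP] : {eps : forall M : qBC, @mor qBC (F (G M)) M |
    forall M : qBC, lifts (replacement (inclusion_object M)) (triv M)
      (idm (sval M)) (eps M)}.
  exists (fun M : qBC => sval (cid (lifts_exists
    (replacement (inclusion_object M)) (triv M) (idm (sval M))))) => M.
  by case: cid.
have p'p (M : CE) : meq (mcomp (p' M) (L _ _ (p M))) (mid _) by exact: loc_invl.
have pp' (M : CE) : meq (mcomp (L _ _ (p M)) (p' M)) (mid _) by exact: loc_invr.
have i'i (M : CE) : meq (mcomp (i' M) (L _ _ (i M))) (mid _) by exact: loc_invl.
have ii' (M : CE) : meq (mcomp (L _ _ (i M)) (i' M)) (mid _) by exact: loc_invr.
have LM (M N P : CE) (g : @mor CE N P) (f : @mor CE M N) :
  meq (L _ _ (mcomp g f)) (mcomp (L _ _ g) (L _ _ f)) by exact: loc_of_comp.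
have natural_of (M N : CE) (f : @mor CE M N) :
    meq (mcomp (fmor G (fmor F (L _ _ f))) (eta M)) (mcomp (eta N) (L _ _ f)).
  have [h [ph ih]] := liftP f; pose Lh := L (cofo M) (cofo N) h.
  have e1 : meq (mcomp (fmor G (fmor F (L _ _ f))) (L _ _ (i M)))
      (mcomp (L _ _ (i N)) Lh).
    have e := LM (cofo M) (G (F M)) (G (F N)) (lift_hom f) (i M).
    apply: meq_trans (meq_sym e) _.
    apply: meq_trans (LM (cofo M) (cofo N) (G (F N)) (i N) h).
    exact: (@loc_of_congr (cofo M) (G (F N)) _ _ (esym ih)).
  have e2 : meq (mcomp (p' N) (L _ _ f)) (mcomp Lh (p' M)).
    apply: (inverse_square (pp' M) (p'p N)).
    apply: meq_trans (meq_sym (LM (cofo M) (cofo N) N (p N) h)) _.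
    apply: meq_trans (LM (cofo M) M N f (p M)).
    exact: (@loc_of_congr (cofo M) N _ _ ph).
  rewrite /eta mcompA e1 -mcompA -e2 mcompA; exact: meq_refl.
exists F, G, eta, eps; split.
- move=> M; apply: iso_comp.
    by exists (i' M); split; [exact: i'i | exact: ii'].
  by exists (L _ _ (p M)); split; [exact: pp' | exact: p'p].
- move=> M; have := lifts_id_equivalence (epsP M).
  by case=> g [g1 g2]; exists g.
- move=> M N l; elim: l => {M N} [M N f|M N s ws|M N P l1 IH1 l2 IH2].
  + exact: natural_of.
  (* Formal inverses: the square at s is reversed, as [lift_inverse] inverts [lift_hom] up to
     homotopy and homotopic maps agree in the localization. *)
  + apply: (inverse_square (s := L _ _ s) (g := fmor G (fmor F (L _ _ s)))).
    * exact: loc_invr.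
    * have [h _] := lift_inverseP ws.
      apply: meq_trans (meq_sym (LM (G (F M)) (G (F N)) (G (F M))
        (lift_inverse ws) (lift_hom s))) _.
      exact: (@homotopic_loc_eq (G (F M)) (G (F M)) _ _ h).
    * exact: natural_of.
  + have e := LM (G (F M)) (G (F N)) (G (F P)) (loc_lift l1) (loc_lift l2).
    apply: meq_trans (mcomp_meq e (meq_refl (eta M))) _.
    apply: meq_trans (meq_sym (mcompA _ _ _)) _.
    apply: meq_trans (mcomp_meq (meq_refl _) IH2) _.
    apply: meq_trans (mcompA _ _ _) _.
    apply: meq_trans (mcomp_meq IH1 (meq_refl _)) _.
    exact: meq_sym (mcompA _ _ _).
(* Both sides of the naturality square lift g between the same replacements. *)
- move=> M N g; have lg : lifts (triv M) (triv N) g g.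
    by exists g; rewrite /= comp1m compm1.
  have l1 := lifts_comp (epsP N)
    (liftP (g : @mor CE (inclusion_object M) (inclusion_object N))).
  have l2 := lifts_comp lg (epsP M).
  rewrite comp1m in l1; rewrite compm1 in l2.
  exact: lifts_unique l1 l2.
Qed.

End Homotopy.

(** * Translation of the hypotheses and assembly *)

Theorem theorem4p6 (C : abelian_category) (X : set C) (m : nat)
    (hX : cotorsion_pair setT X (rperp setT X))
    (hX_hereditary : hereditary setT X (rperp setT X))
    (hX_approx : forall M : C, hat_fin X M ->
       special_precover setT X M /\ special_preenvelope setT (rperp setT X) M) :
  let omega := X `&` rperp setT X in
  complete_cotorsion_pair setT (hat omega m) (rperpi setT 1 (hat omega m)) ->
  forall n : nat, (m <= n)%N -> closed_epikernels (hat omega n) ->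
  let E := hat X n in
  let Q := hat X m in
  let W := hat omega n in
  let R := rperpi setT 1 (hat omega m) `&` hat X n in
  let B := hat X m `&` rperpi setT 1 (hat omega m) in
  let T := hat omega m `&` rperpi setT 1 (hat omega m) in
  [/\ wic_exact_subcategory E,
      hereditary_hovey_triple E Q W R,
      trivially_bifibrant Q W R = T
    & exists cT : congruence (@ideal_rel C B T),
        equivalent_categories (homotopy_category E Q W R)
          (quotient_category cT)].
Proof.
move=> omega hP n le_mn epiker E Q W R B T.
pose Y := rperp setT X; have noE : @closed_extensions C setT by [].
have split_setT (P V : set C) : cotorsion_pair setT P V ->
    (forall A, P A <-> forall D, V D -> split_ext A D) /\
    (forall D, V D <-> forall A, P A -> split_ext A D).
  move=> cot; have [PE VE] := cotorsion_pair_split noE cot; split=> M.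
    by split=> [/PE[]//|h]; apply/PE.
  by split=> [/VE[]//|h]; apply/VE.
have [XE YE] := split_setT _ _ hX.
have XY_splice A D : X A -> Y D -> splice_split A D.
  by move=> XA YD; apply: splice_split_Ext2_eq0; apply: hX_hereditary.
have hat_X k : hat X k = res X k by apply: hat_res; apply: left_class_iso XE.
have hat_core k : hat omega k = res omega k.
  by apply: hat_res; apply: core_iso XE YE.
have X_precover k (M : C) : res X k M ->
    exists K A (i : hom K A) (p : hom A M), [/\ short_exact i p, X A & Y K].
  rewrite -hat_X => rM; have [|/(special_precoverP hX) h _] := hX_approx M.
    by exists k.
  by have [K [A [i [p [[_ _ _ se] XA YK]]]]] := h; exists K, A, i, p.
have X_preenvelope k (M : C) : res X k M ->
    exists D A (i : hom M D) (p : hom D A), [/\ short_exact i p, Y D & X A].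
  rewrite -hat_X => rM; have [|_ /(special_preenvelopeP hX) h] := hX_approx M.
    by exists k.
  by have [D [A [i [p [[_ _ _ se] YD XA]]]]] := h; exists D, A, i, p.
pose V := rperpi setT 1 (hat omega m).
have [hPV hPapprox] := hP; have [PE VE] := split_setT _ _ hPV.
have V_precover (M : C) : exists K A (k : hom K A) (p : hom A M),
    [/\ short_exact k p, res omega m A & V K].
  have [/(special_precoverP hPV) h _] := hPapprox M I; rewrite -hat_core.
  by have [K [A [i [p [[_ _ _ se] XA YK]]]]] := h; exists K, A, i, p.
have V_preenvelope (M : C) : exists D A (i : hom M D) (p : hom D A),
    [/\ short_exact i p, V D & res omega m A].
  have [_ /(special_preenvelopeP hPV) h] := hPapprox M I; rewrite -hat_core.
  by have [D [A [i [p [[_ _ _ se] YD XA]]]]] := h; exists D, A, i, p.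
rewrite -/V hat_core in PE VE; rewrite hat_core in epiker.
have trip : hereditary_hovey_triple E Q W R.
  rewrite /E /Q /W /R !hat_X [hat omega n]hat_core.
  exact: (res_hereditary_hovey_triple XE YE XY_splice X_precover
    X_preenvelope PE VE V_precover V_preenvelope le_mn epiker).
have eQW : Q `&` W = hat omega m.
  rewrite /Q /W !hat_X !hat_core.
  exact: (QW_core XE YE XY_splice X_precover le_mn).
have Q_E : Q `<=` E by rewrite /Q /E !hat_X; exact: (res_leq XE le_mn).
(* R contains the condition of lying in E, which is automatic for objects of Q because m <= n. *)
have eT : trivially_bifibrant Q W R = T.
  rewrite /trivially_bifibrant eQW /R /T setIA; apply/setIidl.
  by rewrite -eQW => M [[QM _] _]; apply: Q_E.
have eB : Q `&` R = B.
  by rewrite /R /B setIA; apply/setIidl => M [QM _]; apply: Q_E.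
have wic : wic_exact_subcategory E.
  by rewrite /E hat_X; apply: (res_wic n XE XY_splice X_precover).
have [E_zero E_ext _] := wic; have [hov _ _] := trip.
have Q_epi : closed_epikernels Q.
  by rewrite /Q hat_X; apply: (res_epikernels XE XY_splice X_precover).
split=> //; rewrite -eB -eT.
exists (homotopic_congruence E_ext E_zero hov).
exact: homotopy_category_equivalence.
Qed.
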